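(* Let $\mathcal{X}=P\mathcal{W}\subset\mathbf{R}^n$ and $\mathcal{B}_*=Q\mathcal{Z}\subset\mathbf{R}^m$ be ellitopes with nonempty interiors, where $P\in\mathbf{R}^{n\times p}$, $Q\in\mathbf{R}^{m\times q}$ and $$\mathcal{W}=\{w\in\mathbf{R}^p:\exists t\in\mathcal{T}: w^TT_kw\le t_k,\ k\le K\},\qquad \mathcal{Z}=\{z\in\mathbf{R}^q:\exists r\in\mathcal{R}: z^TR_\ell z\le r_\ell,\ \ell\le L\}$$ are basic ellitopes, and let $\mathcal{B}=\{u\in\mathbf{R}^m: u^Ty\le 1\ \forall y\in\mathcal{B}_*\}$ be the polar of $\mathcal{B}_*$. Let $A_1,\dots,A_S\in\mathbf{R}^{m\times n}$ be matrices with ranks $\le\kappa$, where $\kappa$ is a positive integer, let $$\mathcal{A}=\Big\{\sum_{s=1}^S\epsilon_sA_s:\ \epsilon\in\mathbf{R}^S,\ \|\epsilon\|_\infty\le1\Big\},\qquad \|\mathcal{A}\|_{\mathcal{B},\mathcal{X}}=\max_{A\in\mathcal{A}}\|A\|_{\mathcal{B},\mathcal{X}},$$ and let $$\mathrm{Opt}=\min_{\lambda\ge0,\ \upsilon\ge0,\ \{G_s,H_s\}}\left\{\phi_{\mathcal{T}}(\lambda)+\phi_{\mathcal{R}}(\upsilon):\ \begin{array}{l}\begin{bmatrix}G_s&\tfrac12Q^TA_sP\\ \tfrac12P^TA_s^TQ&H_s\end{bmatrix}\succeq0,\ s\le S,\\ \sum_sG_s\preceq\sum_\ell\upsilon_\ell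 R_\ell,\quad \sum_sH_s\preceq\sum_k\lambda_kT_k\end{array}\right\},$$ where $\lambda\in\mathbf{R}^K$, $\upsilon\in\mathbf{R}^L$, and $G_s$, $H_s$ are symmetric matrices of sizes $q\times q$ and $p\times p$. Then $$\|\mathcal{A}\|_{\mathcal{B},\mathcal{X}}\le\mathrm{Opt}\le\varkappa(K)\,\varkappa(L)\,\vartheta(2\kappa)\,\|\mathcal{A}\|_{\mathcal{B},\mathcal{X}}.$$
   Context: A basic ellitope is a set $\{w\in\mathbf{R}^p:\exists t\in\mathcal{T}: w^TT_kw\le t_k,\ 1\le k\le K\}$, where $K\ge1$, the $T_k$ are symmetric $p\times p$ matrices with $T_k\succeq0$ and $\sum_kT_k\succ0$, and $\mathcal{T}\subset\mathbf{R}^K_+$ is a convex compact set with nonempty interior which is monotone: $0\le t\le t'$ (entrywise) and $t'\in\mathcal{T}$ imply $t\in\mathcal{T}$. (So in $\mathcal{Z}$ the matrices $R_\ell$, $\ell\le L$, and the set $\mathcal{R}\subset\mathbf{R}^L_+$ satisfy the same requirements.) An ellitope is a linear image of a basic ellitope. $\phi_{\mathcal{T}}(\lambda)=\max_{t\in\mathcal{T}}\lambda^Tt$ is the support function of $\mathcal{T}$, and similarly for $\phi_{\mathcal{R}}$. For a symmetric (w.r.t. the origin) convex compact set $\mathcal{U}$ with nonempty interior, $\|\cdot\|_{\mathcal{U}}$ is the norm with unit ball $\mathcal{U}$. The induced operator norm is $\|A\|_{\mathcal{B},\mathcal{X}}=\max\{\|Ax\|_{\mathcal{B}}:\|x\|_{\mathcal{X}}\le1\}$.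 For positive integers $J$: $\varkappa(1)=1$ and $\varkappa(J)=\tfrac52\sqrt{\ln(2J)}$ for $J>1$. For positive integers $k$: $$\vartheta(k)=\left[\min_{\alpha\in\mathbf{R}^k,\ \|\alpha\|_1=1}(2\pi)^{-k/2}\int_{\mathbf{R}^k}|\alpha_1u_1^2+\dots+\alpha_ku_k^2|\,e^{-u^Tu/2}\,du\right]^{-1}.$$ *)

(* Defs.v *)
From HB Require Import structures.
From mathcomp Require Import all_boot all_order all_algebra.
From mathcomp Require Import all_classical all_reals all_analysis.
Set Implicit Arguments.
Unset Strict Implicit.
Unset Printing Implicit Defensive.
Import Order.TTheory GRing.Theory Num.Theory.
Import numFieldNormedType.Exports.
Local Open Scope classical_set_scope.
Local Open Scope ring_scope.

Section LinearAlgebra.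
Variable R : realType.

Definition qform (p : nat) (M : 'M[R]_p) (x : 'cV[R]_p) : R :=
  (x^T *m M *m x) ord0 ord0.

Definition psdmx (p : nat) (M : 'M[R]_p) : Prop :=
  M^T = M /\ forall x : 'cV[R]_p, 0 <= qform M x.

Definition pdmx (p : nat) (M : 'M[R]_p) : Prop :=
  M^T = M /\ forall x : 'cV[R]_p, x != 0 -> 0 < qform M x.

Definition loewner_le (p : nat) (M N : 'M[R]_p) : Prop := psdmx (N - M).

End LinearAlgebra.

Section Ellitopes.
Variable R : realType.

Definition monotone_set (K : nat) (T : set 'rV[R]_K) : Prop :=
  forall t t' : 'rV[R]_K,
    (forall k, 0 <= t ord0 k <= t' ord0 k) -> T t' -> T t.

Record ellitope_data (p K : nat) (Tm : 'I_K -> 'M[R]_p) (T : set 'rV[R]_K)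
    : Prop := EllitopeData {
  ell_gt0 : (0 < K)%N ;
  ell_psd : forall k, psdmx (Tm k) ;
  ell_sum_pd : pdmx (\sum_k Tm k) ;
  ell_nneg : forall t, T t -> forall k, 0 <= t ord0 k ;
  ell_convex : convex_set T ;
  ell_compact : compact T ;
  ell_interior : T° !=set0 ;
  ell_monotone : monotone_set T }.

Definition basic_ellitope (p K : nat) (Tm : 'I_K -> 'M[R]_p)
    (T : set 'rV[R]_K) : set 'cV[R]_p :=
  [set w | exists2 t, T t & forall k, qform (Tm k) w <= t ord0 k].

(* Here and below a mathematical max (resp. min) is written [sup] (resp.
   [inf]): for the data considered the sets involved are nonempty, bounded on the
   relevant side, and attain their extremum. *)
Definition support_fun (K : nat) (T : set 'rV[R]_K) (lam : 'rV[R]_K) : R :=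
  sup [set \sum_k lam ord0 k * t ord0 k | t in T].

Definition polar (m : nat) (C : set 'cV[R]_m) : set 'cV[R]_m :=
  [set u | forall y, C y -> (u^T *m y) ord0 ord0 <= 1].

(* Minkowski functional: for U symmetric, convex, compact, with nonempty
   interior, this is the norm with unit ball U. *)
Definition gauge_norm (m : nat) (U : set 'cV[R]_m) (x : 'cV[R]_m) : R :=
  inf [set r : R | 0 < r /\ U (r^-1 *: x)].

Definition op_norm (m n : nat) (B : set 'cV[R]_m) (X : set 'cV[R]_n)
    (A : 'M[R]_(m, n)) : R :=
  sup [set gauge_norm B (A *m x) | x in [set x | gauge_norm X x <= 1]].

Definition matrix_box (m n S : nat) (A : 'I_S -> 'M[R]_(m, n))
    : set 'M[R]_(m, n) :=
  [set \sum_s eps s *: A s | eps in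
     [set eps : 'I_S -> R | forall s, `|eps s| <= 1]].

Definition set_op_norm (m n : nat) (B : set 'cV[R]_m) (X : set 'cV[R]_n)
    (AA : set 'M[R]_(m, n)) : R :=
  sup [set op_norm B X A | A in AA].

End Ellitopes.

Section Relaxation.
Variable R : realType.
Variables (n m p q K L S : nat).
Variables (P : 'M[R]_(n, p)) (Q : 'M[R]_(m, q)).
Variables (Tm : 'I_K -> 'M[R]_p) (T : set 'rV[R]_K).
Variables (Rm : 'I_L -> 'M[R]_q) (RR : set 'rV[R]_L).
Variable (A : 'I_S -> 'M[R]_(m, n)).

Record opt_feasible (lam : 'rV[R]_K) (ups : 'rV[R]_L)
    (G : 'I_S -> 'M[R]_q) (H : 'I_S -> 'M[R]_p) : Prop := OptFeasible {
  feas_lam : forall k, 0 <= lam ord0 k ;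
  feas_ups : forall l, 0 <= ups ord0 l ;
  feas_Gsym : forall s, (G s)^T = G s ;
  feas_Hsym : forall s, (H s)^T = H s ;
  feas_block : forall s, psdmx
    (block_mx (G s) (2^-1 *: (Q^T *m A s *m P))
              (2^-1 *: (P^T *m (A s)^T *m Q)) (H s)) ;
  feas_G : loewner_le (\sum_s G s) (\sum_l ups ord0 l *: Rm l) ;
  feas_H : loewner_le (\sum_s H s) (\sum_k lam ord0 k *: Tm k) }.

Definition Opt : R :=
  inf [set v : R | exists lam ups G H, opt_feasible lam ups G H /\
                     v = support_fun T lam + support_fun RR ups].

End Relaxation.

Section Constants.
Variable R : realType.

Definition varkappa (J : nat) : R :=
  if (1 < J)%N then 5 / 2 * Num.sqrt (ln (2 * J)%N%:R) else 1.

(* Lebesgue measure on R^k, as the k-fold product of the Lebesgue measure on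
   R, transported to tuples by (x, u) |-> x :: u. *)
Fixpoint lebesgue_tuple (k : nat) :
    set (k.-tuple (measurableTypeR R)) -> \bar R :=
  match k with
  | 0 => dirac [tuple]
  | k'.+1 => pushforward (lebesgue_measure \x (@lebesgue_tuple k'))%E
               (fun xu : measurableTypeR R * k'.-tuple (measurableTypeR R) =>
                  [tuple of xu.1 :: xu.2])
  end.

Lemma lebesgue_tuple_box (k : nat) :
  exists2 mu : {sigma_finite_measure
                set (k.-tuple (measurableTypeR R)) -> \bar R},
   mu = @lebesgue_tuple k :> (set _ -> \bar R) &
   forall F : 'I_k -> set (measurableTypeR R), (forall i, measurable (F i)) ->
     mu [set u | forall i, F i (tnth u i)] = (\prod_i lebesgue_measure (F i))%E.
Proof.
elim: k => [|k [mu muE mubox]].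
  exists (dirac [tuple] : {sigma_finite_measure set _ -> \bar R}) => //.
  move=> F _; rewrite big_ord0 /= diracE mem_set//. by case.
pose c := (fun xu : measurableTypeR R * k.-tuple (measurableTypeR R) => [tuple of xu.1 :: xu.2]).
have mc : measurable_fun setT c.
  by apply: (@measurable_cons _ _ _ _ fst _ snd).

pose nu := measure_function_pushforward__canonical__measure_function_Measure (lebesgue_measure \x mu)%E mc.
have nuE : nu = @lebesgue_tuple k.+1 :> (set _ -> \bar R).
  by rewrite /= -muE.
have cyl (E : set (measurableTypeR R)) (G : set (k.-tuple (measurableTypeR R))) :
   measurable E -> measurable G ->
   measurable [set u : k.+1.-tuple _ | E (tnth u ord0) /\ G [tuple of behead u]] /\
   nu [set u : k.+1.-tuple _ | E (tnth u ord0) /\ G [tuple of behead u]] = (lebesgue_measure E * mu G)%E.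
  move=> mE mG; split.
    rewrite (_ : mkset _ = ((@tnth _ _)^~ ord0 @^-1` E) `&` ((fun x : k.+1.-tuple (measurableTypeR R) => [tuple of behead x]) @^-1` G)) //.
    apply: measurableI; rewrite -[X in measurable X]setTI.
      exact: measurable_tnth.
    exact: measurable_behead.
  rewrite -product_measure1E//= /pushforward; congr (_ _).
  apply/seteqP; split => -[x u] /= [Ex Gu]; split=> //; move: Gu; congr (G _); exact/val_inj.
have sf : sigma_finite setT nu.
  have /sigma_finiteP[F [FT _ Foo]] := sigma_finiteT (@lebesgue_measure R).
  have /sigma_finiteP[G [GT ndG Goo]] := sigma_finiteT mu.
  have /sigma_finiteP[F' [FT' ndF' Foo']] := sigma_finiteT (@lebesgue_measure R).
  exists (fun n => [set u : k.+1.-tuple _ | F' n (tnth u ord0) /\ G n [tuple of behead u]]).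
    apply/esym/seteqP; split => // u _.
    have : setT (tnth u ord0) by []. rewrite FT' => -[i _ Fi].
    have : setT [tuple of behead u] by []. rewrite GT => -[j _ Gj].
    exists (maxn i j) => //; split.
      by move: Fi; exact/subsetPset/ndF'/leq_maxl.
    by move: Gj; exact/subsetPset/ndG/leq_maxr.
  move=> n; have [mF Fn] := Foo' n; have [mG Gn] := Goo n.
  have [m1 ->] := cyl _ _ mF mG; split => //.
  by rewrite lte_mul_pinfty// ge0_fin_numE.
pose sfm := Measure_isSigmaFinite.Build _ _ _ nu sf.
pose nu' : {sigma_finite_measure set _ -> \bar R} := HB.pack (nu : set _ -> \bar R) nu sfm.
exists nu' => //.
move=> F mF; rewrite big_ord_recl -mubox => [|i]; last exact: mF.
have mbox : measurable [set u : k.-tuple (measurableTypeR R) | forall i, F (lift ord0 i) (tnth u i)].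
  rewrite (_ : mkset _ = \bigcap_(i : 'I_k) ((@tnth _ _)^~ i @^-1` F (lift ord0 i))); last first.
    by apply/seteqP; split => u /= h i; [move=> _; exact: h|exact: h].
  apply: fin_bigcap_measurable => // i _; rewrite -[X in measurable X]setTI.
  exact: measurable_tnth.
have [_ <-] := cyl _ _ (mF ord0) mbox.
congr (nu _); apply/seteqP; split => u /= h.
  by split=> // i; rewrite tnth_behead (_ : inord _ = lift ord0 i)//; apply/val_inj; rewrite /= inordK// ltnS.
case: h => h0 h i; case: (unliftP ord0 i) => [j|] -> //.
by have := h j; rewrite tnth_behead (_ : inord _ = lift ord0 j)//; apply/val_inj; rewrite /= inordK// ltnS.
Qed.

Definition gauss_abs_quad (k : nat) (alpha : 'rV[R]_k) : R :=
  (2 * pi) `^ (- (k%:R / 2)) *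
  fine (\int[@lebesgue_tuple k]_u
    (`| \sum_i alpha ord0 i * (tnth u i : R) ^+ 2 |
       * expR (- (\sum_i (tnth u i : R) ^+ 2) / 2))%:E)%E.

Definition vartheta (k : nat) : R :=
  (inf [set gauss_abs_quad alpha | alpha in
          [set alpha : 'rV[R]_k | \sum_i `|alpha ord0 i| = 1]])^-1.

End Constants.

(* Main.v *)
(* The operator norm of [\sum_s eps_s A_s] maximized over the sign vectors [eps] is the
   maximum of [\sum_s |z^T M_s w|] over [z] in [Z] and [w] in [W], where
   [M_s = Q^T A_s P]. A feasible solution bounds [|z^T M_s w|] by
   [z^T G_s z + w^T H_s w], which gives the lower bound on [Opt].

   For the upper bound, put the matrices [M_s / 2] and [M_s^T / 2] off the diagonal of
   a symmetric matrix [X_s] of size [q + p]; the block constraint says that some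
   [Th_s] satisfies [- Th_s <= X_s <= Th_s]. Conic duality (separation of 0 from the
   convex set of perturbed constraints) reduces the claim to the following: if
   [Sig > 0] has traces against the ellitope matrices bounded by some [t] and [r],
   then [\sum_s tr (Sig Th_s) <= varkappa K * varkappa L * vartheta (2 kappa) * N] for
   some such [Th_s], where [N] is the norm. Write [Sig = F F^T]; the best [Th_s] has
   [tr (Sig Th_s)] equal to the sum of the moduli of the at most [2 kappa] nonzero
   eigenvalues of [F^T X_s F], and by the definition of [vartheta] and the rotation
   invariance of the Gaussian measure this is at most
   [vartheta (2 kappa) * E |v^T F^T X_s F v|] for a standard Gaussian vector [v].
   Finally, with [(z, w) = F v], one has
   [\sum_s |z^T M_s w| <= N |z|_Z |w|_W], and the second moments of [|w|_W] and [|z|_Z]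
   are at most [varkappa K ^ 2] and [varkappa L ^ 2]. *)
Require Import Defs.
From mathcomp Require Import all_boot all_order all_algebra.
From mathcomp Require Import all_classical all_reals all_analysis.
From mathcomp Require Import measurable_realfun ring lra.
Import Order.TTheory GRing.Theory Num.Theory.
Import numFieldNormedType.Exports.
Local Open Scope classical_set_scope.
Local Open Scope ring_scope.

Set Implicit Arguments.
Unset Strict Implicit.
Unset Printing Implicit Defensive.

(** Every optimum is used with room to spare: duality is shown for each value strictly above the
    bound, and the optimal value and the gauges are approached within [e], so that attainment never
    enters. Strictness also keeps 0 at positive distance from the perturbed constraints. Separation
    yields only a semidefinite matrix. Mixing in a small multiple of the identity makes it definite,
    so that [F] is invertible and the modulus of [F^T X_s F] can be carried back to a matrix
    dominating [X_s]. The inverse in [vartheta] is of use only if the infimum is positive; this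
    rests on bounding E |sum_i a_i g_i^2| below by a multiple of each |a_i|. The product of the two
    norms is split by a weighted arithmetic-geometric mean inequality. The second moment for K forms
    comes from E exp (3/8 g^2) = 2, which leads to 8/3 ln (2 K), below (5/2)^2 ln (2 K). *)

(** * Strict separation of a point from a convex set *)

Section Separation.
Variable R : realType.

Lemma closure_coordP n (C : set 'rV[R]_n) (y : 'rV[R]_n) :
  closure C y <->
  forall e : R, 0 < e -> exists2 x, C x & forall j, `|y ord0 j - x ord0 j| < e.
Proof.
split=> [Cy e e0|h B /nbhs_ballP [e /= e0 eB]].
  have [x [Cx]] := Cy _ (nbhsx_ballx y e e0).
  by case=> _ xy; exists x => // j; exact: xy.
have [x Cx xy] := h _ e0; exists x; split => //; apply: eB; split => // i j.
by rewrite ord1; exact: xy.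
Qed.

Lemma continuous_sumR (T : topologicalType) (I : Type) (r : seq I) (f : I -> T -> R) :
  (forall i, continuous (f i)) -> continuous (fun x => \sum_(i <- r) f i x).
Proof.
move=> cf; elim: r => [|i r ih] x.
  under eq_fun do rewrite big_nil.
  exact: cvg_cst.
under eq_fun do rewrite big_cons.
by apply: cvgD; [exact: cf|exact: ih].
Qed.

Lemma continuous_mulR (T : topologicalType) (f g : T -> R) :
  continuous f -> continuous g -> continuous (fun x => f x * g x).
Proof. by move=> cf cg x; apply: continuousM; [exact: cf|exact: cg]. Qed.

Lemma continuous_sqr_sub (T : topologicalType) (f : T -> R) (c : R) :
  continuous f -> continuous (fun x => (f x - c) ^+ 2).
Proof.
move=> cf x; apply: (@continuous_comp _ _ _ (fun x => f x - c) (fun y => y ^+ 2)).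
  by apply: cvgB; [exact: cf|exact: cvg_cst].
exact: exprn_continuous.
Qed.

Lemma rV_coord_compact n (A : set 'rV[R]_n) (b : R) : closed A ->
  (forall x, A x -> forall j, `|x ord0 j| <= b) -> compact A.
Proof.
move=> Acl Ab.
have cb : compact [set v : 'rV[R]_n | forall i, `[(- b), b]%classic (v ord0 i)].
  by apply: (@rV_compact R^o n (fun=> `[(- b), b]%classic)) => _; exact: segment_compact.
apply: subclosed_compact Acl cb _ => v Av i /=.
by rewrite in_itv /= -ler_norml Ab.
Qed.

(** The normal [v] goes from [x0] to the Euclidean-nearest point of the closure of [C]. The
    hypothesis on [d] keeps [x0] at sup-norm distance at least [d] from [C]. *)
Lemma convex_separation n (C : set 'rV[R]_n) (x0 : 'rV[R]_n) (d : R) : 0 < d ->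
  (forall x y t, C x -> C y -> 0 <= t <= 1 -> C (t *: x + (1 - t) *: y)) ->
  (forall x, C x -> exists j, d <= `|x ord0 j - x0 ord0 j|) ->
  exists (v : 'rV[R]_n) (e : R), 0 < e /\ forall x, C x ->
    \sum_j v ord0 j * x0 ord0 j + e <= \sum_j v ord0 j * x ord0 j.
Proof.
move=> d0 Cconv Cfar.
have [[x1 Cx1]|C0] := pselect (C !=set0); last first.
  by exists 0, 1; split => // x Cx; exfalso; apply: C0; exists x.
pose f (x : 'rV[R]_n) := \sum_j (x ord0 j - x0 ord0 j) ^+ 2.
have cf : continuous f.
  apply: continuous_sumR => j; apply: continuous_sqr_sub.
  exact: coord_continuous.
have f0 x : 0 <= f x by apply: sumr_ge0 => j _; exact: sqr_ge0.
pose A := closure C `&` [set x | f x <= f x1].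
have Acl : closed A.
  apply: closedI; first exact: closed_closure.
  rewrite (_ : mkset _ = f @^-1` [set r | r <= f x1]) //.
  by apply: closed_comp => [x _|]; [exact: cf|exact: closed_le].
have Ab x : A x -> forall j, `|x ord0 j| <= `|x0|%R + (f x1 + 1).
  move=> [_ /= fx] j.
  have h : (x ord0 j - x0 ord0 j) ^+ 2 <= f x1.
    apply: le_trans fx; rewrite /f (bigD1 j) //= lerDl.
    by apply: sumr_ge0 => i _; exact: sqr_ge0.
  have h2 : `|x ord0 j - x0 ord0 j| <= f x1 + 1.
    rewrite -(real_normK (num_real _)) in h.
    by have := normr_ge0 (x ord0 j - x0 ord0 j); have := f0 x1; nra.
  have h3 : `|x0 ord0 j| <= `|x0|.
    by rewrite [leRHS]/Num.norm /= mx_normrE; apply/bigmax_geP; right => /=; exists (ord0, j).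
  rewrite -[x ord0 j](subrK (x0 ord0 j)).
  by apply: le_trans (ler_normD _ _) _; rewrite addrC lerD.
have cA := rV_coord_compact Acl Ab.
have A0 : A !=set0 by exists x1; split; [exact: subset_closure|rewrite /= lexx].
have [y yA ymin] := @EVT_min_rV _ _ f _ A0 cA (continuous_subspaceT cf).
have {yA} [yC yx1] : A y by rewrite inE in yA.
pose v := y - x0.
have vE : f y = \sum_j v ord0 j ^+ 2.
  by apply: eq_bigr => j _; rewrite !mxE.
have fy0 : 0 < f y.
  have d2 : 0 < d / 2 by lra.
  have [x Cx yx] := (closure_coordP _ _).1 yC _ d2.
  have [j dj] := Cfar _ Cx; have := yx j => yxj.
  have h : 0 < `|y ord0 j - x0 ord0 j|.
    have := ler_normD (x ord0 j - y ord0 j) (y ord0 j - x0 ord0 j).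
    rewrite addrA subrK (distrC (x ord0 j) (y ord0 j)); lra.
  rewrite /f (bigD1 j) //= ltr_wpDr //.
    by apply: sumr_ge0 => i _; exact: sqr_ge0.
  by rewrite exprn_even_gt0 //= -normr_gt0.
exists v, (f y / 2); split; first by lra.
move=> x Cx.
(* [y] minimizes [f] only on the compact set [A]; outside the sublevel set of [x1] the inequality
   holds anyway. *)
have key t : 0 <= t <= 1 -> f y <= f (t *: x + (1 - t) *: y).
  move=> t01; have [|/ltW] := leP (f (t *: x + (1 - t) *: y)) (f x1); last first.
    by move=> h; apply: le_trans yx1 h.
  move=> h; apply: ymin; rewrite inE; split => //.
  apply/closure_coordP => e e0; have [z Cz yz] := (closure_coordP _ _).1 yC _ e0.
  exists (t *: x + (1 - t) *: z); first exact: Cconv.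
  move=> j; rewrite !mxE.
  rewrite (_ : _ - _ = (1 - t) * (y ord0 j - z ord0 j)); last by ring.
  rewrite normrM ger0_norm; last by lra.
  by apply: le_lt_trans (yz j); apply: ler_piMl => //; lra.
pose g := \sum_j v ord0 j * (x ord0 j - y ord0 j).
pose h := \sum_j (x ord0 j - y ord0 j) ^+ 2.
have fE t : f (t *: x + (1 - t) *: y) = f y + 2 * t * g + t ^+ 2 * h.
  rewrite /f /g /h !mulr_sumr -!big_split /=; apply: eq_bigr => j _.
  by rewrite !mxE; ring.
have h0 : 0 <= h by apply: sumr_ge0 => j _; exact: sqr_ge0.
have g0 : 0 <= g.
  rewrite leNgt; apply/negP => gneg.
  (* With t (h + 1) <= - g the increment 2 t g + t^2 h is at most t g < 0, against minimality. *)
  pose t := Num.min 1 (- g / (h + 1)).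
  have hp : 0 < h + 1 by lra.
  have t1 : t <= 1 by rewrite ge_min lexx.
  have tg : t * (h + 1) <= - g by rewrite -ler_pdivlMr // ge_min lexx orbT.
  have t0 : 0 < t by rewrite lt_min ltr01 divr_gt0 // oppr_gt0.
  have := key t; rewrite fE => /(_ _); rewrite (ltW t0) t1 => /(_ isT).
  nra.
suff -> : \sum_j v ord0 j * x ord0 j = \sum_j v ord0 j * x0 ord0 j + f y + g.
  by rewrite -addrA lerD2l; lra.
by rewrite vE /g -!big_split /=; apply: eq_bigr => j _; rewrite !mxE; ring.
Qed.

End Separation.

(** * Quadratic and bilinear forms; existence of an eigenvector *)

Section QuadraticForms.
Variable R : realType.

Definition bform p q (M : 'M[R]_(p, q)) (x : 'cV[R]_p) (y : 'cV[R]_q) : R :=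
  (x^T *m M *m y) ord0 ord0.

Lemma bformE p q (M : 'M[R]_(p, q)) x y :
  bform M x y = \sum_i \sum_j x i ord0 * M i j * y j ord0.
Proof.
rewrite /bform mxE exchange_big; apply: eq_bigr => j _.
by rewrite !mxE mulr_suml; apply: eq_bigr => i _; rewrite !mxE.
Qed.

Lemma bform_tr p q (M : 'M[R]_(p, q)) x y : bform M^T y x = bform M x y.
Proof.
rewrite !bformE exchange_big; apply: eq_bigr => i _; apply: eq_bigr => j _.
by rewrite mxE; ring.
Qed.

Lemma bformDl p q (M : 'M[R]_(p, q)) x y z : bform M (x + y) z = bform M x z + bform M y z.
Proof. by rewrite /bform linearD /= !mulmxDl mxE. Qed.

Lemma bformDr p q (M : 'M[R]_(p, q)) x y z : bform M z (x + y) = bform M z x + bform M z y.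
Proof. by rewrite /bform mulmxDr mxE. Qed.

Lemma bformZl p q (M : 'M[R]_(p, q)) a x z : bform M (a *: x) z = a * bform M x z.
Proof. by rewrite /bform linearZ /= -!scalemxAl mxE. Qed.

Lemma bformZr p q (M : 'M[R]_(p, q)) a x z : bform M z (a *: x) = a * bform M z x.
Proof. by rewrite /bform -!scalemxAr mxE. Qed.

Lemma bform_addmx p q (M N : 'M[R]_(p, q)) x y : bform (M + N) x y = bform M x y + bform N x y.
Proof. by rewrite /bform mulmxDr mulmxDl mxE. Qed.

Lemma bform_scalemx p q a (M : 'M[R]_(p, q)) x y : bform (a *: M) x y = a * bform M x y.
Proof. by rewrite /bform -scalemxAr -scalemxAl mxE. Qed.

Lemma bform_summx p q (I : Type) (r : seq I) (F : I -> 'M[R]_(p, q)) x y :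
  bform (\sum_(i <- r) F i) x y = \sum_(i <- r) bform (F i) x y.
Proof. by rewrite /bform mulmx_sumr mulmx_suml summxE. Qed.

Lemma bform_mulmx p q k l (M : 'M[R]_(p, q)) (E : 'M[R]_(p, k)) (F : 'M[R]_(q, l)) x y :
  bform M (E *m x) (F *m y) = bform (E^T *m M *m F) x y.
Proof. by rewrite /bform trmx_mul !mulmxA. Qed.

Lemma qform_bform p (M : 'M[R]_p) x : qform M x = bform M x x.
Proof. by []. Qed.

Lemma qform_addmx p (M N : 'M[R]_p) x : qform (M + N) x = qform M x + qform N x.
Proof. exact: bform_addmx. Qed.

Lemma qform_scalemx p a (M : 'M[R]_p) x : qform (a *: M) x = a * qform M x.
Proof. exact: bform_scalemx. Qed.

Lemma qform_oppmx p (M : 'M[R]_p) x : qform (- M) x = - qform M x.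
Proof. by rewrite -scaleN1r qform_scalemx mulN1r. Qed.

Lemma qform_summx p (I : Type) (r : seq I) (F : I -> 'M[R]_p) x :
  qform (\sum_(i <- r) F i) x = \sum_(i <- r) qform (F i) x.
Proof. exact: bform_summx. Qed.

Lemma qformZ p (M : 'M[R]_p) a x : qform M (a *: x) = a ^+ 2 * qform M x.
Proof. by rewrite !qform_bform bformZl bformZr mulrA. Qed.

Lemma qform_mulmx p k (M : 'M[R]_p) (E : 'M[R]_(p, k)) x :
  qform M (E *m x) = qform (E^T *m M *m E) x.
Proof. exact: bform_mulmx. Qed.

Lemma qformD p (M : 'M[R]_p) x y : M^T = M ->
  qform M (x + y) = qform M x + 2 * bform M x y + qform M y.
Proof.
move=> sM; rewrite !qform_bform bformDl !bformDr -[bform M y x]bform_tr sM; ring.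
Qed.

Lemma qform1 p (x : 'cV[R]_p) : qform 1%:M x = \sum_i x i ord0 ^+ 2.
Proof.
rewrite /qform mulmx1 mxE; apply: eq_bigr => i _.
by rewrite mxE expr2.
Qed.

Lemma qform_diag p (d : 'rV[R]_p) x : qform (diag_mx d) x = \sum_i d ord0 i * x i ord0 ^+ 2.
Proof.
rewrite qform_bform bformE; apply: eq_bigr => i _; rewrite (bigD1 i) //= big1 ?addr0.
  by rewrite mxE eqxx mulr1n; ring.
by move=> j ji; rewrite mxE eq_sym (negbTE ji) mulr0n; ring.
Qed.

Lemma qform1_eq0 p (x : 'cV[R]_p) : qform 1%:M x = 0 -> x = 0.
Proof.
rewrite qform1 => /eqP; rewrite psumr_eq0 => [/allP h|i _]; last exact: sqr_ge0.
apply/matrixP => i j; rewrite ord1 mxE.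
by have /= := h i (mem_index_enum i); rewrite sqrf_eq0 => /eqP.
Qed.

Lemma qform1_gt0 p (x : 'cV[R]_p) : x != 0 -> 0 < qform 1%:M x.
Proof.
move=> x0; rewrite lt_neqAle eq_sym; apply/andP; split.
  by apply: contra x0 => /eqP /qform1_eq0 ->.
by rewrite qform1 sumr_ge0 // => i _; exact: sqr_ge0.
Qed.

(** Moving from [x] by [t] times [M x] changes the form by 2 t |M x|^2 + O(t^2), which is negative
    for small t < 0 unless [M x] vanishes. *)
Lemma psdmx_qform0 p (M : 'M[R]_p) x : psdmx M -> qform M x = 0 -> M *m x = 0.
Proof.
move=> [sM M0] Mx0; apply: qform1_eq0; apply/eqP.
set y := M *m x; set b := qform _ y; set c := qform M y.
have b0 : 0 <= b by rewrite /b qform1 sumr_ge0 // => i _; exact: sqr_ge0.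
have bE : bform M x y = b.
  by rewrite /b qform_bform /bform mulmx1 /y [in RHS]trmx_mul sM.
have c0 : 0 <= c by exact: M0.
rewrite eq_le b0 andbT leNgt; apply/negP => bp.
pose t := - b / (c + 1).
have tE : t * (c + 1) = - b by rewrite divfK // gt_eqF //; lra.
have t0 : t < 0 by nra.
have := M0 (x + t *: y); rewrite qformD // Mx0 bformZr bE qformZ -/c; nra.
Qed.

(** If [c] maximizes the form on the unit sphere, then [f c *: 1%:M - M] is semidefinite and
    vanishes at [c] as a form, so [c] lies in its kernel. *)
Lemma unit_eigenvector p (M : 'M[R]_p.+1) : M^T = M ->
  exists (v : 'cV[R]_p.+1) (a : R), qform 1%:M v = 1 /\ M *m v = a *: v.
Proof.
move=> sM.
pose f (r : 'rV[R]_p.+1) := qform M r^T.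
have cf : continuous f.
  rewrite (_ : f = fun r => \sum_i \sum_j r ord0 i * M i j * r ord0 j); last first.
    apply/funext => r; rewrite /f qform_bform bformE.
    by apply: eq_bigr => i _; apply: eq_bigr => j _; rewrite !mxE.
  apply: continuous_sumR => i; apply: continuous_sumR => j.
  apply: continuous_mulR; last exact: coord_continuous.
  by apply: continuous_mulR; [exact: coord_continuous|exact: cst_continuous].
pose g (r : 'rV[R]_p.+1) := \sum_j (r ord0 j - 0) ^+ 2.
have gE r : g r = qform 1%:M r^T.
  by rewrite qform1; apply: eq_bigr => j _; rewrite mxE subr0.
have cg : continuous g.
  by apply: continuous_sumR => j; apply: continuous_sqr_sub; exact: coord_continuous.
pose A := [set r | g r = 1].
have Acl : closed A.
  rewrite (_ : A = g @^-1` [set r | r = 1]) //.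
  by apply: closed_comp => [x _|]; [exact: cg|exact: closed_eq].
have Ab x : A x -> forall j, `|x ord0 j| <= 1.
  rewrite /A /= => gx j; have : x ord0 j ^+ 2 <= 1.
    rewrite -gx /g (bigD1 j) //= subr0 lerDl; apply: sumr_ge0 => i _; exact: sqr_ge0.
  by rewrite -(real_normK (num_real _)); have := normr_ge0 (x ord0 j); nra.
have cA := rV_coord_compact Acl Ab.
have A0 : A !=set0.
  exists (\row_j (j == ord0)%:R); rewrite /A /= /g (bigD1 ord0) //= big1.
    by rewrite !mxE eqxx subr0 expr1n addr0.
  by move=> i i0; rewrite mxE (negbTE i0) subr0 expr0n.
have [c cA' cmax] := @EVT_max_rV _ _ f _ A0 cA (continuous_subspaceT cf).
have {cA'} c1 : g c = 1 by rewrite inE in cA'.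
exists c^T, (f c); split; first by rewrite -gE.
have psd : psdmx (f c *: 1%:M - M).
  split; first by rewrite linearB /= linearZ /= trmx1 sM.
  move=> x; rewrite qform_addmx qform_oppmx qform_scalemx subr_ge0.
  have [->|x0] := eqVneq x 0.
    by rewrite -[0](scale0r (0 : 'cV[R]_p.+1)) !qformZ expr0n !mul0r mulr0.
  have q0 := qform1_gt0 x0; set s := qform 1%:M x in q0 *.
  have := cmax ((Num.sqrt s)^-1 *: x^T); rewrite inE /f /A /= gE.
  rewrite linearZ /= trmxK !qformZ exprVn sqr_sqrtr ?(ltW q0) // -/s mulVf ?gt_eqF //.
  by move=> /(_ erefl); rewrite mulrC ler_pdivrMr.
have := psdmx_qform0 (x := c^T) psd; rewrite qform_addmx qform_oppmx qform_scalemx -gE c1 mulr1.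
rewrite -/(f c) subrr => /(_ erefl) /eqP.
by rewrite mulmxBl -scalemxAl mul1mx subr_eq0 => /eqP ->.
Qed.

End QuadraticForms.

(** * Lebesgue measure on column vectors and its invariance *)

Section LebesgueOnColumns.
Variable R : realType.
Local Notation mR := (measurableTypeR R).
Local Notation leb := (@lebesgue_measure R).

(** [lebesgue_tuple] packed with the sigma-finiteness that Tonelli's theorem asks for. *)
Definition lebesgue_sigma_finite k : {sigma_finite_measure set (k.-tuple mR) -> \bar R} :=
  projT1 (cid2 (lebesgue_tuple_box R k)).
Local Notation lebk := lebesgue_sigma_finite.

Lemma lebkE k : lebk k = @lebesgue_tuple R k :> (set _ -> _).
Proof. by rewrite /lebesgue_sigma_finite; case: cid2. Qed.

Definition col_of_tuple k (u : k.-tuple mR) : 'cV[R]_k := \col_i tnth u i.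
Local Notation cvt := col_of_tuple.

(** Measurability is read through tuples, where the product sigma-algebra lives. *)
Definition mcol k (f : 'cV[R]_k -> R) :=
  measurable_fun setT (fun u : k.-tuple mR => f (cvt u) : mR).

Lemma mcol_comp d (T : measurableType d) k (g : T -> 'cV[R]_k) (f : 'cV[R]_k -> R) :
  (forall i, measurable_fun setT (fun t => g t i ord0 : mR)) -> mcol f ->
  measurable_fun setT (fun t => f (g t) : mR).
Proof.
move=> mg mf.
rewrite (_ : (fun t => _) =
    (fun u : k.-tuple mR => f (cvt u) : mR) \o (fun t => [tuple g t i ord0 : mR | i < k])).
  apply: measurableT_comp => //; apply/measurable_fun_tnthP => i.
  rewrite (_ : _ \o _ = fun t => g t i ord0 : mR) //.
  by apply/funext => t /=; rewrite tnth_mktuple.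
apply/funext => t /=; congr f; apply/matrixP => i j.
by rewrite ord1 mxE tnth_mktuple.
Qed.

Lemma measurable_cvt k (i : 'I_k) : measurable_fun setT (fun u : k.-tuple mR => cvt u i ord0 :
  mR).
Proof.
rewrite (_ : (fun u => _) = (fun u : k.-tuple mR => tnth u i)); first exact: measurable_tnth.
by apply/funext => u; rewrite mxE.
Qed.

Lemma cvt_cons k x (u : k.-tuple mR) : cvt [tuple of x :: u] = col_mx (x%:M : 'M[R]_1) (cvt u).
Proof.
apply/matrixP => i j; rewrite ord1 mxE /col_mx mxE.
case: splitP => l il.
  by rewrite !mxE ord1 eqxx mulr1n (tnth_nth x) il ord1.
rewrite !mxE !(tnth_nth x) il //.
Qed.

Definition Lint k (f : 'cV[R]_k -> R) : \bar R := (\int[lebk k]_u (f (cvt u))%:E)%E.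

Lemma mcol_cons k (f : 'cV[R]_(1 + k) -> R) : mcol f ->
  measurable_fun setT (fun xu : mR * k.-tuple mR => f (col_mx (xu.1%:M : 'M[R]_1) (cvt xu.2)) :
    mR).
Proof.
move=> mf; apply: mcol_comp mf => i.
case: (split_ordP i) => j ->.
  rewrite (_ : (fun _ => _) = fst) //.
  by apply/funext => -[x u]; rewrite col_mxEu ord1 mxE eqxx mulr1n.
rewrite (_ : (fun _ => _) = (fun u => cvt u j ord0 : mR) \o snd).
  by apply: measurableT_comp => //; exact: measurable_cvt.
by apply/funext => -[x u]; rewrite col_mxEd.
Qed.

Lemma Lint0 (f : 'cV[R]_0 -> R) : (forall v, 0 <= f v) -> mcol f -> Lint f = (f 0)%:E.
Proof.
move=> f0 mf; rewrite /Lint lebkE /= integral_dirac //; last exact/measurable_EFinP.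
rewrite diracT mul1e; congr (f _)%:E; by apply/matrixP => -[].
Qed.

Lemma LintP k (f : 'cV[R]_(1 + k) -> R) : (forall v, 0 <= f v) -> mcol f ->
  Lint f = (\int[leb \x lebk k]_xu (f (col_mx (xu.1%:M : 'M[R]_1) (cvt xu.2)))%:E)%E.
Proof.
move=> f0 mf; rewrite /Lint lebkE /= -lebkE.
rewrite ge0_integral_pushforward //.
- by apply: eq_integral => -[x u] _ /=; rewrite -cvt_cons.
- by apply: (@measurable_cons _ _ _ _ fst _ snd).
- exact/measurable_EFinP.
- by move=> y _; rewrite lee_fin.
Qed.

Lemma LintS k (f : 'cV[R]_(1 + k) -> R) : (forall v, 0 <= f v) -> mcol f ->
  Lint f = (\int[leb]_x Lint (fun v => f (col_mx (x%:M : 'M[R]_1) v)))%E.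
Proof.
move=> f0 mf; rewrite LintP // fubini_tonelli1 //.
  by apply/measurable_EFinP; exact: mcol_cons.
by move=> x; rewrite lee_fin.
Qed.

Lemma LintS2 k (f : 'cV[R]_(1 + k) -> R) : (forall v, 0 <= f v) -> mcol f ->
  Lint f = (\int[lebk k]_u \int[leb]_x (f (col_mx (x%:M : 'M[R]_1) (cvt u)))%:E)%E.
Proof.
move=> f0 mf; rewrite LintP // fubini_tonelli2 //.
  by apply/measurable_EFinP; exact: mcol_cons.
by move=> x; rewrite lee_fin.
Qed.

(** The translated measure agrees with Lebesgue measure on intervals, hence everywhere by
    uniqueness. *)
Lemma lebesgue_shift (f : R -> \bar R) (a : R) : (forall x, 0 <= f x)%E ->
  measurable_fun setT (f : mR -> \bar R) ->
  (\int[leb]_x f (x + a)%R)%E = (\int[leb]_x f x)%E.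
Proof.
move=> f0 mf.
pose s : mR -> mR := fun x : R => x + a.
have ms : measurable_fun setT s by apply: measurable_funD.
transitivity (\int[pushforward leb s]_x f x)%E.
  by rewrite ge0_integral_pushforward.
apply: eq_measure_integral => A mA _; apply/esym.
pose nu := measure_function_pushforward__canonical__measure_function_Measure leb ms.
apply: (@lebesgue_measure_unique R nu) => // _ [[b c]] _ <-.
rewrite /= /pushforward.
rewrite (_ : _ @^-1` _ = `]b - a, c - a]%classic); last first.
  by apply/seteqP; split => x /=; rewrite !in_itv /= ltrBlDr lerBrDr.
rewrite !lebesgue_measure_itv /= !lte_fin ltrD2r.
by case: ifP => // _; rewrite -!EFinB; congr EFin; ring.
Qed.

Lemma mcol_affine k l (B : 'M[R]_(k, l)) (b : 'cV[R]_k) (f : 'cV[R]_k -> R) :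
  mcol f -> mcol (fun v => f (B *m v + b)).
Proof.
move=> mf; apply: mcol_comp mf => i.
rewrite (_ : (fun _ => _) = fun u : l.-tuple mR => \sum_j B i j * cvt u j ord0 + b i ord0);
  last first.
  by apply/funext => u; rewrite !mxE; congr (_ + _); apply: eq_bigr => j _; rewrite !mxE.
apply: measurable_funD => //; apply: measurable_sum => j.
by apply: measurable_funM => //; exact: measurable_cvt.
Qed.

Lemma mcol_mulmx k l (B : 'M[R]_(k, l)) (f : 'cV[R]_k -> R) :
  mcol f -> mcol (fun v => f (B *m v)).
Proof.
by move=> /(@mcol_affine _ _ B 0); under eq_fun do rewrite addr0.
Qed.

Lemma mcol_col_mx k (x : R) (f : 'cV[R]_(1 + k) -> R) :
  mcol f -> mcol (fun v => f (col_mx (x%:M : 'M[R]_1) v)).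
Proof.
move=> mf; apply: mcol_comp mf => i.
case: (split_ordP i) => j ->.
  by under eq_fun do rewrite col_mxEu; exact: measurable_cst.
under eq_fun do rewrite col_mxEd.
exact: measurable_cvt.
Qed.

Lemma mcol_row k (x : 'cV[R]_k) (f : 'cV[R]_(1 + k) -> R) :
  mcol f -> measurable_fun setT ((fun t => f (col_mx (t%:M : 'M[R]_1) x)) : mR -> mR).
Proof.
move=> mf; apply: mcol_comp mf => i.
case: (split_ordP i) => j ->.
  under eq_fun do rewrite col_mxEu ord1 mxE eqxx mulr1n.
  exact: measurable_id.
under eq_fun do rewrite col_mxEd; exact: measurable_cst.
Qed.

Lemma scalar_mxDE k (a b : R) : (a + b)%:M = a%:M + b%:M :> 'M[R]_k.
Proof. exact: raddfD. Qed.

(** With the first coordinate integrated innermost, the shear is a translation of the line by a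
    constant. *)
Lemma Lint_shear_top k (a : 'M[R]_(1, k)) (a0 : 'M[R]_1) (f : 'cV[R]_(1 + k) -> R) :
  (forall v, 0 <= f v) -> mcol f ->
  Lint (fun w => f (block_mx 1%:M a 0 1%:M *m w + col_mx a0 0)) = Lint f.
Proof.
move=> f0 mf; have mg := mcol_affine (block_mx 1%:M a 0 1%:M) (col_mx a0 0) mf.
rewrite (LintS2 (fun v => f0 _) mg) (LintS2 f0 mf); apply: eq_integral => u _.
rewrite -[RHS](lebesgue_shift ((a *m cvt u + a0) ord0 ord0)); last 2 first.
- by move=> x; rewrite lee_fin.
- by apply/measurable_EFinP; exact: mcol_row.
apply: eq_integral => x _; congr (f _)%:E.
rewrite mul_block_col !mul1mx mul0mx add0r add_col_mx addr0 -addrA; congr col_mx.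
by rewrite scalar_mxDE -mx11_scalar.
Qed.

(** For a fixed first coordinate x the map is the translation by b x + b0 in dimension [k].
    Translation invariance there is a hypothesis because the induction proving [Lint_shift] calls
    this lemma. *)
Lemma Lint_shear_bot_aux k (b b0 : 'cV[R]_k) (f : 'cV[R]_(1 + k) -> R) :
  (forall (g : 'cV[R]_k -> R) c, (forall v, 0 <= g v) -> mcol g ->
    Lint (fun v => g (v + c)) = Lint g) ->
  (forall v, 0 <= f v) -> mcol f ->
  Lint (fun w => f (block_mx 1%:M 0 b 1%:M *m w + col_mx 0 b0)) = Lint f.
Proof.
move=> h f0 mf; have mg := mcol_affine (block_mx 1%:M 0 b 1%:M) (col_mx 0 b0) mf.
rewrite (LintS (fun v => f0 _) mg) (LintS f0 mf); apply: eq_integral => x _.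
rewrite -[RHS](h _ (b *m x%:M + b0)) //; last exact: mcol_col_mx.
congr (Lint _); apply/funext => v; congr f.
by rewrite mul_block_col !mul1mx mul0mx addr0 add_col_mx addr0 addrAC addrC addrA.
Qed.

(** A translation is the composite of a top and a bottom shear whose off-diagonal blocks are
    zero. *)
Lemma Lint_shift k (f : 'cV[R]_k -> R) (b : 'cV[R]_k) : (forall v, 0 <= f v) -> mcol f ->
  Lint (fun v => f (v + b)) = Lint f.
Proof.
elim: k f b => [|k ih] f b f0 mf.
  rewrite (_ : (fun v => _) = f) //; apply/funext => v; congr f.
  by apply/matrixP => -[].
rewrite -[RHS](Lint_shear_top 0 (usubmx (b : 'cV_(1 + k)))) //
  -(@Lint_shear_bot_aux _ 0 (dsubmx (b : 'cV_(1 + k)))) //.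
- congr (Lint _); apply/funext => v; congr f.
  rewrite -scalar_mx_block !mul1mx -addrA add_col_mx add0r addr0.
  by rewrite [v + _]addrC -[in LHS](vsubmxK (b : 'cV_(1 + k))) addrC.
- exact: mcol_affine.
Qed.

Lemma Lint_shear_bot k (b b0 : 'cV[R]_k) (f : 'cV[R]_(1 + k) -> R) :
  (forall v, 0 <= f v) -> mcol f ->
  Lint (fun w => f (block_mx 1%:M 0 b 1%:M *m w + col_mx 0 b0)) = Lint f.
Proof. by apply: Lint_shear_bot_aux => g c; exact: Lint_shift. Qed.

(* Orthogonal matrices known to preserve Lebesgue measure; they suffice to
   diagonalize symmetric matrices, see [spectral_decomposition]. *)
Definition isometry_mx k (O : 'M[R]_k) : Prop :=
  O^T *m O = 1%:M /\ forall f : 'cV[R]_k -> R, (forall v, 0 <= f v) -> mcol f ->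
    Lint (fun v => f (O *m v)) = Lint f.

Lemma isometry_mx1 k : isometry_mx (1%:M : 'M[R]_k).
Proof.
split; first by rewrite trmx1 mulmx1.
by move=> f f0 mf; under eq_fun do rewrite mul1mx.
Qed.

Lemma isometry_mxM k (O P : 'M[R]_k) : isometry_mx O -> isometry_mx P -> isometry_mx (O *m P).
Proof.
move=> [OO Of] [PP Pf]; split.
  by rewrite trmx_mul mulmxA -(mulmxA P^T) OO mulmx1.
move=> f f0 mf; under eq_fun do rewrite -mulmxA.
by rewrite (Pf (fun v => f (O *m v))) ?Of //; exact: mcol_mulmx.
Qed.

Lemma isometry_mx_block k (O : 'M[R]_k) : isometry_mx O ->
  isometry_mx (block_mx 1%:M 0 0 O : 'M[R]_(1 + k)).
Proof.
move=> [OO Of]; split.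
  by rewrite tr_block_mx mulmx_block !trmx1 !trmx0 !(mulmx0, mul0mx, addr0, add0r,
    mulmx1) OO -scalar_mx_block.
move=> f f0 mf; rewrite (LintS (fun v => f0 _) (mcol_mulmx _ mf)) (LintS f0 mf);
  apply: eq_integral => x _.
rewrite -[RHS]Of //; last exact: mcol_col_mx.
congr (Lint _); apply/funext => v; congr f.
by rewrite mul_block_col !(mul1mx, mul0mx, addr0, add0r).
Qed.

(* The rotation in the plane spanned by [e_1] and [(c, w)], as a product of
   three shears. *)
Lemma isometry_mx_rotation k (c : R) (w : 'cV[R]_k) : c != -1 -> c ^+ 2 + qform 1%:M w = 1 ->
  exists2 O : 'M[R]_(1 + k), isometry_mx O & O *m col_mx 1%:M 0 = col_mx c%:M w.
Proof.
move=> c1 cw.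
have c10 : 1 + c != 0 by rewrite addrC; apply: contra c1 => /eqP h; apply/eqP; lra.
have wTw : w^T *m w = (qform 1%:M w)%:M by rewrite [LHS]mx11_scalar /qform mulmx1.
(* A plane rotation by an angle u is the product of shears with parameters - tan (u/2), sin u, - tan
   (u/2). Here c = cos u, |w| = sin u up to sign, and tan (u/2) = sin u / (1 + cos u); the half turn
   c = -1 is excluded. *)
pose t := (1 + c)^-1.
pose S1 : 'M[R]_(1 + k) := block_mx 1%:M (- t *: w^T) 0 1%:M.
pose S2 : 'M[R]_(1 + k) := block_mx 1%:M 0 w 1%:M.
have tE : t * (1 - c ^+ 2) = 1 - c by rewrite /t; field.
have cwE : qform 1%:M w = 1 - c ^+ 2 by lra.
pose O : 'M[R]_(1 + k) := block_mx c%:M (- w^T) w (1%:M - t *: (w *m w^T)).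
have OE : S1 *m S2 *m S1 = O.
  rewrite /S1 /S2 !mulmx_block !(mul1mx, mulmx1, mulmx0, mul0mx, addr0, add0r).
  have h1 : 1%:M + - t *: w^T *m w = c%:M.
    rewrite -scalemxAl wTw scale_scalar_mx cwE mulNr tE -scalar_mxDE; congr (_%:M); ring.
  rewrite h1; congr block_mx.
    rewrite mul_scalar_mx scalerA -scalerDl -[RHS]scaleN1r; congr (_ *: _).
    rewrite /t; field => //.
  by rewrite -scalemxAr scaleNr addrC.
exists O; last first.
  by rewrite /O mul_block_col !mulmx0 !addr0 !mulmx1.
split.
  have trO : (1%:M - t *: (w *m w^T))^T = 1%:M - t *: (w *m w^T).
    by rewrite linearB linearZ /= trmx_mul trmxK trmx1.
  have wO : w^T *m (1%:M - t *: (w *m w^T)) = c *: w^T.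
    rewrite mulmxBr mulmx1 -scalemxAr mulmxA wTw mul_scalar_mx scalerA cwE tE.
    by rewrite -[X in X - _]scale1r -scalerBl; congr (_ *: _); ring.
  have Ow : (1%:M - t *: (w *m w^T)) *m w = c *: w.
    by apply: trmx_inj; rewrite trmx_mul trO wO linearZ.
  rewrite /O tr_block_mx mulmx_block trO tr_scalar_mx -scalar_mxM.
  rewrite (linearN (@trmx _ _ _)) /= trmxK.
  rewrite wTw wO !mulNmx !mulmxN Ow mul_scalar_mx mul_mx_scalar !addNr opprK.
  rewrite -scalar_mxDE cwE (_ : c * c + _ = 1); last by ring.
  rewrite mulmxBr mulmx1 -scalemxAr mulmxA Ow -scalemxAl scalerA.
  rewrite (_ : w *m w^T + _ = 1%:M) -?scalar_mx_block //.
  rewrite -addrA -opprD -scalerDl (_ : t + t * c = 1) ?scale1r;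
    first by rewrite addrCA subrr addr0.
  by rewrite /t; field.
move=> f f0 mf.
have h1 (g : 'cV[R]_(1 + k) -> R) : (forall v, 0 <= g v) -> mcol g ->
  Lint (fun v => g (S1 *m v)) = Lint g.
  move=> g0 mg; rewrite -[RHS](Lint_shear_top (- t *: w^T) 0) //.
  by under [in RHS]eq_fun do rewrite col_mx0 addr0.
have h2 (g : 'cV[R]_(1 + k) -> R) : (forall v, 0 <= g v) -> mcol g ->
  Lint (fun v => g (S2 *m v)) = Lint g.
  move=> g0 mg; rewrite -[RHS](Lint_shear_bot w 0) //.
  by under [in RHS]eq_fun do rewrite col_mx0 addr0.
rewrite -OE; under eq_fun do rewrite -!mulmxA.
have m1 := mcol_mulmx S1 mf; have m2 := mcol_mulmx S2 m1.
rewrite (h1 (fun v => f (S1 *m (S2 *m v)))) //.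
by rewrite (h2 (fun v => f (S1 *m v))) ?h1 //; exact: mcol_mulmx.
Qed.

End LebesgueOnColumns.

(** * Spectral theorem with measure-preserving rotations *)

Section Spectral.
Variable R : realType.

(** Deflation: a rotation taking e_1 to a unit eigenvector splits off a block of size 1, and the
    induction treats the rest. *)
Lemma spectral_decomposition k (M : 'M[R]_k) : M^T = M ->
  exists (O : 'M[R]_k) (d : 'rV[R]_k), isometry_mx O /\ M = O *m diag_mx d *m O^T.
Proof.
elim: k M => [|k ih] M sM.
  exists 1%:M, 0; split; first exact: isometry_mx1.
  by apply/matrixP => -[].
have [v0 [a [v01 Mv0]]] := unit_eigenvector sM.
(* The opposite eigenvector serves equally well, which avoids the half turn excluded by
   [isometry_mx_rotation]. *)
wlog vc : v0 v01 Mv0 / v0 ord0 ord0 != -1.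
  move=> h; have [v1|] := eqVneq (v0 ord0 ord0) (-1); last exact: h.
  apply: (h (- v0)).
  - by rewrite -scaleN1r qformZ v01 mulr1 sqrrN expr1n.
  - by rewrite mulmxN Mv0 scalerN.
  - by rewrite mxE v1 opprK gt_eqF // (lt_trans (ltrN10 R) ltr01).
pose v : 'cV[R]_(1 + k) := v0; pose c := v0 ord0 ord0; pose w := dsubmx v.
have vE : v = col_mx c%:M w.
  rewrite -[LHS]vsubmxK; congr col_mx; rewrite [LHS]mx11_scalar !mxE; congr (_%:M).
  by congr (v0 _ _); apply/val_inj.
have cw : c ^+ 2 + qform 1%:M w = 1.
  transitivity (qform 1%:M v); last exact: v01.
  rewrite !qform1 big_split_ord /= big_ord1; congr (_ + _).
    by rewrite vE col_mxEu mxE eqxx mulr1n.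
  by apply: eq_bigr => i _; rewrite [in RHS]vE col_mxEd.
have [U1 [UU Uf] Ue] := isometry_mx_rotation vc cw.
rewrite -vE in Ue.
pose N := U1^T *m (M : 'M[R]_(1 + k)) *m U1.
have sN : N^T = N by rewrite /N !trmx_mul trmxK sM mulmxA.
have Ne : N *m col_mx 1%:M 0 = a *: col_mx 1%:M 0.
  have Mv : (M : 'M[R]_(1 + k)) *m v = a *: v := Mv0.
  rewrite /N -!mulmxA Ue Mv -scalemxAr -Ue mulmxA UU mul1mx //.
pose N' := drsubmx N.
have NE : N = block_mx a%:M 0 0 N'.
  have [ul dl] : ulsubmx N = a%:M /\ dlsubmx N = 0.
    have := Ne; rewrite -{1}[N]submxK mul_block_col !mulmx0 !addr0 !mulmx1 scale_col_mx scaler0.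
    by move=> {}Ne; move: (eq_col_mx Ne); rewrite scale_scalar_mx mulr1.
  have ur : ursubmx N = 0 by rewrite -[N]sN -trmx_dlsub dl trmx0.
  by rewrite -[LHS]submxK ul dl ur.
have sN' : N'^T = N' by rewrite /N' trmx_drsub sN.
have [ O' [d' [[OO' Of'] N'E]]] := ih N' sN'.
pose O2 : 'M[R]_(1 + k) := block_mx 1%:M 0 0 O'.
have iO2 : isometry_mx O2 by apply: isometry_mx_block.
have NO : N = O2 *m diag_mx (row_mx a%:M d') *m O2^T.
  rewrite NE N'E diag_mx_row /O2 tr_block_mx !mulmx_block.
  rewrite !(trmx1, trmx0, mulmx0, mul0mx, mulmx1, mul1mx, addr0, add0r).
  by congr block_mx; apply/matrixP => i j; rewrite !ord1 !mxE eqxx.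
exists (U1 *m O2), (row_mx a%:M d'); split; first by apply: isometry_mxM.
have UUt := mulmx1C UU.
transitivity (U1 *m N *m U1^T).
  by rewrite /N !mulmxA UUt mul1mx -mulmxA UUt mulmx1.
by rewrite NO trmx_mul !mulmxA.
Qed.

End Spectral.

(** * Standard Gaussian expectation and scalar moments *)

Section GaussianExpectation.
Variable R : realType.
Local Notation mR := (measurableTypeR R).
Local Notation leb := (@lebesgue_measure R).
Local Notation phi := (normal_pdf (0 : R) 1).

Lemma mcol_cst k (c : R) : mcol (fun _ : 'cV[R]_k => c).
Proof. exact: measurable_cst. Qed.

Lemma mcol_coord k (i : 'I_k) : mcol (fun v : 'cV[R]_k => v i ord0).
Proof. exact: measurable_cvt. Qed.

Lemma mcolD k (f g : 'cV[R]_k -> R) : mcol f -> mcol g -> mcol (fun v => f v + g v).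
Proof. exact: measurable_funD. Qed.

Lemma mcolM k (f g : 'cV[R]_k -> R) : mcol f -> mcol g -> mcol (fun v => f v * g v).
Proof. exact: measurable_funM. Qed.

Lemma mcol_sum k (I : Type) (r : seq I) (f : I -> 'cV[R]_k -> R) :
  (forall i, mcol (f i)) -> mcol (fun v => \sum_(i <- r) f i v).
Proof. by move=> mf; apply: measurable_sum. Qed.

Lemma mcol_compR k (g : R -> R) (f : 'cV[R]_k -> R) :
  measurable_fun setT (g : mR -> mR) -> mcol f -> mcol (fun v => g (f v)).
Proof. by move=> mg mf; apply: measurableT_comp. Qed.

Lemma mcol_qform k (M : 'M[R]_k) : mcol (qform M).
Proof.
rewrite (_ : qform M = fun v => \sum_i \sum_j v i ord0 * M i j * v j ord0); last first.
  by apply/funext => v; rewrite qform_bform bformE.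
apply: mcol_sum => i; apply: mcol_sum => j.
apply: mcolM; last exact: mcol_coord.
by apply: mcolM; [exact: mcol_coord|exact: mcol_cst].
Qed.

Lemma measurable_expRmR : measurable_fun setT (expR : mR -> mR).
Proof. exact: measurable_expR. Qed.

Lemma measurable_normrmR : measurable_fun setT (Num.norm : mR -> mR).
Proof. exact: normr_measurable. Qed.

Lemma measurable_phi : measurable_fun setT (phi : mR -> mR).
Proof. exact: measurable_normal_pdf. Qed.

Definition gpdf k (v : 'cV[R]_k) : R := normal_peak 1 ^+ k * expR (- qform 1%:M v / 2).

Lemma gpdf_ge0 k (v : 'cV[R]_k) : 0 <= gpdf v.
Proof. by rewrite mulr_ge0 ?expR_ge0 // exprn_ge0 // normal_peak_ge0. Qed.

Lemma mcol_gpdf k : mcol (@gpdf k).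
Proof.
apply: mcolM; first exact: mcol_cst.
apply: (mcol_compR measurable_expRmR).
apply: mcolM; last exact: mcol_cst.
rewrite (_ : (fun v => _) = (fun v : 'cV_k => qform (- 1%:M) v)); first exact: mcol_qform.
by apply/funext => v; rewrite qform_oppmx.
Qed.

Lemma phiE x : phi x = normal_peak 1 * expR (- x ^+ 2 / 2).
Proof. by rewrite normal_pdfE ?oner_eq0 // /normal_fun subr0 expr1n. Qed.

Lemma phi_ge0 x : 0 <= phi x.
Proof. exact: normal_pdf_ge0. Qed.

Lemma gpdf_cons k x (v : 'cV[R]_k) : gpdf (col_mx (x%:M : 'M[R]_1) v) = phi x * gpdf v.
Proof.
rewrite phiE /gpdf mulrACA -expRD; congr (_ * expR _); first by rewrite exprD expr1.
rewrite -mulrDl -opprD; congr (- _ / _).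
rewrite qform1 big_split_ord /= big_ord1 col_mxEu mxE eqxx mulr1n qform1; congr (_ + _).
by apply: eq_bigr => i _; rewrite col_mxEd.
Qed.

(** Expectation for the standard Gaussian law, with values in the extended reals: it is applied to
    nonnegative functions, without asking for integrability. *)
Definition gE k (f : 'cV[R]_k -> R) : \bar R := Lint (fun v => f v * gpdf v).

Section Pointwise.
Variable k : nat.
Implicit Types f g : 'cV[R]_k -> R.

Let mfg f : mcol f -> mcol (fun v => f v * gpdf v).
Proof. by move=> mf; apply: mcolM mf (@mcol_gpdf k). Qed.

Let fg0 f : (forall v, 0 <= f v) -> forall v, 0 <= f v * gpdf v.
Proof. by move=> f0 v; rewrite mulr_ge0 // gpdf_ge0. Qed.

Lemma gE_ge0 f : (forall v, 0 <= f v) -> (0 <= gE f)%E.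
Proof. by move=> f0; apply: integral_ge0 => u _; rewrite lee_fin fg0. Qed.

(** The density depends on the Euclidean norm only. *)
Lemma gE_isometry (O : 'M[R]_k) f : isometry_mx O -> (forall v, 0 <= f v) -> mcol f ->
  gE (fun v => f (O *m v)) = gE f.
Proof.
move=> [OO Of] f0 mf; rewrite /gE -(Of _ (fg0 f0) (mfg mf)).
congr (Lint _); apply/funext => v; congr (_ * _).
by rewrite /gpdf qform_mulmx mulmx1 OO.
Qed.

Lemma gED f g : (forall v, 0 <= f v) -> mcol f -> (forall v, 0 <= g v) -> mcol g ->
  gE (fun v => f v + g v) = (gE f + gE g)%E.
Proof.
move=> f0 mf g0 mg; rewrite /gE /Lint -ge0_integralD //.
- by apply: eq_integral => u _; rewrite mulrDl EFinD.
- by move=> u _; rewrite lee_fin fg0.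
- by apply/measurable_EFinP; exact: mfg.
- by move=> u _; rewrite lee_fin fg0.
- by apply/measurable_EFinP; exact: mfg.
Qed.

Lemma gEZ (c : R) f : 0 <= c -> (forall v, 0 <= f v) -> mcol f ->
  gE (fun v => c * f v) = (c%:E * gE f)%E.
Proof.
move=> c0 f0 mf; rewrite /gE /Lint -ge0_integralZl //.
- by apply: eq_integral => u _; rewrite -mulrA EFinM.
- by apply/measurable_EFinP; exact: mfg.
- by move=> u _; rewrite lee_fin fg0.
Qed.

Lemma le_gE f g : (forall v, 0 <= f v) -> mcol f -> mcol g -> (forall v, f v <= g v) ->
  (gE f <= gE g)%E.
Proof.
move=> f0 mf mg fg; apply: ge0_le_integral => //.
- by move=> u _; rewrite lee_fin fg0.
- by apply/measurable_EFinP; exact: mfg.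
- by apply/measurable_EFinP; exact: mfg.
- by move=> u _; rewrite lee_fin ler_wpM2r // gpdf_ge0.
Qed.

Lemma gE_sum (I : Type) (r : seq I) (f : I -> 'cV[R]_k -> R) :
  (forall i v, 0 <= f i v) -> (forall i, mcol (f i)) ->
  gE (fun v => \sum_(i <- r) f i v) = (\sum_(i <- r) gE (f i))%E.
Proof.
move=> f0 mf; elim: r => [|i r ih].
  rewrite big_nil /gE /Lint integral0_eq // => u _.
  by rewrite big_nil mul0r.
rewrite big_cons -ih -gED //.
- by congr gE; apply/funext => v; rewrite big_cons.
- by move=> v; apply: sumr_ge0.
- exact: mcol_sum.
Qed.

End Pointwise.

Lemma gES k (f : 'cV[R]_(1 + k) -> R) : (forall v, 0 <= f v) -> mcol f ->
  gE f = (\int[leb]_x ((phi x)%:E * gE (fun v => f (col_mx (x%:M : 'M[R]_1) v))))%E.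
Proof.
move=> f0 mf; rewrite /gE LintS; last 2 first.
- by move=> v; rewrite mulr_ge0 // gpdf_ge0.
- by apply: mcolM => //; exact: mcol_gpdf.
apply: eq_integral => x _.
have mfx := mcol_col_mx x mf.
rewrite /Lint -ge0_integralZl ?lee_fin ?phi_ge0 //.
- by apply: eq_integral => u _; rewrite gpdf_cons -EFinM mulrCA.
- by apply/measurable_EFinP; exact: (mcolM mfx (@mcol_gpdf k)).
- by move=> u _; rewrite lee_fin mulr_ge0 // gpdf_ge0.
Qed.

Lemma measurable_gE_cons k (f : 'cV[R]_(1 + k) -> R) : (forall v, 0 <= f v) -> mcol f ->
  measurable_fun setT ((fun x => (phi x)%:E * gE (fun v => f (col_mx (x%:M : 'M[R]_1) v)))%E :
    mR -> \bar R).
Proof.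
move=> f0 mf; apply: emeasurable_funM.
  by apply/measurable_EFinP; exact: measurable_phi.
rewrite /gE /Lint.
pose h (xu : mR * k.-tuple mR) :=
  (f (col_mx (xu.1%:M : 'M[R]_1) (col_of_tuple xu.2)) * gpdf (col_of_tuple xu.2))%:E.
have := (measurable_fun_fubini_tonelli_F (m2 := lebesgue_sigma_finite R k) h); apply; last first.
  by move=> xu; rewrite lee_fin mulr_ge0 // gpdf_ge0.
apply/measurable_EFinP; apply: measurable_funM; first exact: mcol_cons.
apply: mcol_comp (@mcol_gpdf k) => i.
exact: (measurableT_comp (measurable_cvt i) measurable_snd).
Qed.

Lemma integral_phi_cst (c : \bar R) : (0 <= c)%E -> (\int[leb]_x ((phi x)%:E * c))%E = c.
Proof.
move=> c0; rewrite ge0_integralZr //.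
- by rewrite integral_normal_pdf mul1e.
- by apply/measurable_EFinP; exact: measurable_phi.
- by move=> x _; rewrite lee_fin phi_ge0.
Qed.

Lemma gE_cst k (c : R) : 0 <= c -> gE (fun _ : 'cV[R]_k => c) = c%:E.
Proof.
move=> c0; elim: k => [|k ih].
  rewrite /gE Lint0.
  - by rewrite /gpdf expr0 mul1r qform1 big_ord0 oppr0 mul0r expR0 mulr1.
  - by move=> v; rewrite mulr_ge0 // gpdf_ge0.
  - by apply: mcolM; [exact: mcol_cst|exact: mcol_gpdf].
rewrite gES //; last exact: mcol_cst.
by rewrite ih integral_phi_cst // lee_fin.
Qed.

Lemma gE_coord k (i : 'I_k) (g : R -> R) : (forall x, 0 <= g x) ->
  measurable_fun setT (g : mR -> mR) ->
  gE (fun v : 'cV[R]_k => g (v i ord0)) = (\int[leb]_x (phi x * g x)%:E)%E.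
Proof.
move=> g0 mg; elim: k i => [[] //|k ih] i.
have mc j : mcol (fun v : 'cV[R]_(1 + k) => g (v j ord0)).
  by apply: (mcol_compR mg); exact: mcol_coord.
rewrite (gES (fun v => g0 _) (mc i)).
case: (split_ordP (i : 'I_(1 + k))) => j ij.
  apply: eq_integral => x _; rewrite EFinM; congr (_ * _)%E.
  rewrite -[RHS](gE_cst k (g0 x)); congr gE; apply/funext => v.
  by rewrite ij col_mxEu ord1 mxE eqxx mulr1n.
under eq_integral => x _.
  rewrite (_ : (fun v => _) = (fun v : 'cV[R]_k => g (v j ord0))); last first.
    by apply/funext => v; rewrite ij col_mxEd.
  over.
rewrite ih integral_phi_cst //; apply: integral_ge0 => x _.
by rewrite lee_fin mulr_ge0 // phi_ge0.
Qed.

(** The integrand is [s] times the density of the centered normal law of standard deviation [s]. The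
    exponent 3/8 used later is the case s = 2. *)
Lemma integral_phi_exp (s : R) : 0 < s ->
  (\int[leb]_x (phi x * expR ((1 - s ^- 2) / 2 * x ^+ 2))%:E)%E = s%:E.
Proof.
move=> s0; rewrite -[RHS]mule1 -(integral_normal_pdf 0 s) -ge0_integralZl //; last 3 first.
- by apply/measurable_EFinP; exact: measurable_normal_pdf.
- by move=> x _; rewrite lee_fin normal_pdf_ge0.
- by rewrite lee_fin ltW.
apply: eq_integral => x _; rewrite -EFinM; congr EFin.
rewrite phiE normal_pdfE ?gt_eqF // /normal_peak /normal_fun subr0 expr1n mul1r.
rewrite -[LHS]mulrA -expRD [RHS]mulrA; congr (_ * expR _); last first.
  by field; rewrite gt_eqF.
rewrite -mulrnAr sqrtrM ?sqr_ge0 // sqrtr_sqr gtr0_norm // invfM mulrA divff ?gt_eqF // mul1r //.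
Qed.

Lemma integral_phi_exp38 : (\int[leb]_x (phi x * expR (3 / 8 * x ^+ 2))%:E)%E = 2%:E.
Proof.
have -> : 3 / 8 = (1 - 2 ^- 2) / 2 :> R by field.
exact: integral_phi_exp.
Qed.

(** The second moment is extracted from the exponential one by 1 + a x^2 <= exp (a x^2), which gives
    the bound (s - 1) / a. As s tends to 1 this tends to 1. *)
Lemma integral_phi_sqr_le (s : R) : 1 < s ->
  (\int[leb]_x (phi x * x ^+ 2)%:E <= (2 * s ^+ 2 / (s + 1))%:E)%E.
Proof.
move=> s1; pose a := (1 - s ^- 2) / 2.
have s0 : 0 < s by lra.
have a0 : 0 < a by rewrite /a divr_gt0 // subr_gt0 invf_lt1 ?exprn_gt0 // exprn_egt1.
have : (a%:E * \int[leb]_x (phi x * x ^+ 2)%:E + 1%:E <= s%:E)%E.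
  rewrite -(integral_phi_exp s0) -(integral_normal_pdf (0 : R) 1) -ge0_integralZl //;
    last 3 first.
  - apply/measurable_EFinP; apply: measurable_funM; first exact: measurable_phi.
    exact: exprn_measurable.
  - by move=> x _; rewrite lee_fin mulr_ge0 ?phi_ge0 // sqr_ge0.
  - by rewrite lee_fin ltW.
  rewrite -ge0_integralD //; last 4 first.
  - by move=> x _; rewrite -EFinM lee_fin mulr_ge0 ?(ltW a0) // mulr_ge0 ?phi_ge0 // sqr_ge0.
  - apply/measurable_EFinP; apply: measurable_funM => //; apply: measurable_funM;
      first exact: measurable_phi.
    exact: exprn_measurable.
  - by move=> x _; rewrite lee_fin phi_ge0.
  - by apply/measurable_EFinP; exact: measurable_phi.
  apply: ge0_le_integral => //.
  - by move=> x _; rewrite -EFinM -EFinD lee_fin addr_ge0 ?phi_ge0 // mulr_ge0 ?(ltW a0) //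
      mulr_ge0 ?phi_ge0 // sqr_ge0.
  - apply/measurable_EFinP; apply: measurable_funD; last exact: measurable_phi.
    apply: measurable_funM => //; apply: measurable_funM; first exact: measurable_phi.
    exact: exprn_measurable.
  - apply/measurable_EFinP; apply: measurable_funM; first exact: measurable_phi.
    apply: measurableT_comp; first exact: measurable_expRmR.
    by apply: measurable_funM => //; exact: exprn_measurable.
  - move=> x _; rewrite -EFinM -EFinD lee_fin.
    rewrite (_ : _ + _ = phi x * (1 + a * x ^+ 2)); last by ring.
    by rewrite ler_wpM2l ?phi_ge0 // expR_ge1Dx.
have sE : (s - 1) / a = 2 * s ^+ 2 / (s + 1).
  rewrite /a; field.
  have s21 : 0 < s ^+ 2 - 1 by nra.
  have s11 : 0 < s + 1 by lra.
  by rewrite !gt_eqF.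
case: (\int[_]_x _)%E => [r| |] /=; last by move=> _; rewrite leNye.
  by rewrite -EFinM -EFinD !lee_fin -lerBrDr mulrC -ler_pdivlMr // sE.
by rewrite gt0_muley ?lte_fin.
Qed.

Lemma integral_phi_sqr_le1 : (\int[leb]_x (phi x * x ^+ 2)%:E <= 1%:E)%E.
Proof.
have h := @integral_phi_sqr_le.
have : (0 <= \int[leb]_x (phi x * x ^+ 2)%:E)%E.
  by apply: integral_ge0 => x _; rewrite lee_fin mulr_ge0 ?phi_ge0 // sqr_ge0.
case: (\int[_]_x _)%E h => [r| |] //= h _; last by have := h 2 (ltr1n R 2).
rewrite lee_fin leNgt; apply/negP => r1.
(* With r = 1 + 4 d and s = 1 + d the bound reads (1 + 4 d) (2 + d) <= 2 (1 + d)^2, false for d >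
   0. *)
pose d := (r - 1) / 4.
have d0 : 0 < d by rewrite /d; lra.
have := h (1 + d); rewrite lee_fin ltrDl d0 => /(_ isT).
rewrite ler_pdivlMr; last by lra.
rewrite (_ : r = 1 + 4 * d); last by rewrite /d; field.
nra.
Qed.

End GaussianExpectation.

(** * Gaussian moments of quadratic forms *)

Section GaussianQuadraticForms.
Variable R : realType.
Local Notation mR := (measurableTypeR R).
Local Notation leb := (@lebesgue_measure R).
Local Notation phi := (normal_pdf (0 : R) 1).

Lemma qform_delta k (M : 'M[R]_k) i : qform M (delta_mx i ord0) = M i i.
Proof. by rewrite /qform trmx_delta -rowE -colE !mxE. Qed.

Lemma qform_orthogonal k (O : 'M[R]_k) d v : O^T *m O = 1%:M ->
  qform (O *m diag_mx d *m O^T) (O *m v) = \sum_i d ord0 i * v i ord0 ^+ 2.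
Proof.
move=> OO; rewrite -qform_diag qform_mulmx; congr (qform _ v).
by rewrite !mulmxA OO mul1mx -mulmxA OO mulmx1.
Qed.

Lemma mxtrace_orthogonal k (O : 'M[R]_k) (d : 'rV[R]_k) : O^T *m O = 1%:M ->
  \tr (O *m diag_mx d *m O^T) = \sum_i d ord0 i.
Proof. by move=> OO; rewrite mxtrace_mulC mulmxA OO mul1mx mxtrace_diag. Qed.

Lemma psdmx_spectrum k (M : 'M[R]_k) : psdmx M ->
  exists (O : 'M[R]_k) (d : 'rV[R]_k),
    [/\ isometry_mx O, M = O *m diag_mx d *m O^T & forall i, 0 <= d ord0 i].
Proof.
move=> [sM M0]; have [U [d [iO ME]]] := spectral_decomposition sM.
exists U, d; split => // i; have := M0 (U *m delta_mx i ord0).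
rewrite ME qform_orthogonal ?(proj1 iO) // (bigD1 i) //= big1.
  by rewrite mxE !eqxx expr1n mulr1 addr0.
by move=> j ji; rewrite mxE (negbTE ji) /= expr0n mulr0.
Qed.

Lemma gE_sqr_coord_le k (i : 'I_k) : (gE (fun v : 'cV[R]_k => v i ord0 ^+ 2)%R <= 1)%E.
Proof.
rewrite (@gE_coord _ _ i (fun x => x ^+ 2)).
- exact: integral_phi_sqr_le1.
- by move=> x; exact: sqr_ge0.
- exact: exprn_measurable.
Qed.

Lemma mcol_sqr_coord k (i : 'I_k) : mcol (fun v : 'cV[R]_k => v i ord0 ^+ 2).
Proof. by apply: (mcol_compR (@exprn_measurable R setT 2)); exact: mcol_coord. Qed.

Lemma gE_sum_sqr_le k (d : 'I_k -> R) : (forall i, 0 <= d i) ->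
  (gE (fun v : 'cV[R]_k => \sum_i d i * v i ord0 ^+ 2)%R <= (\sum_i d i)%:E)%E.
Proof.
move=> d0; rewrite gE_sum; last 2 first.
- by move=> i v; rewrite mulr_ge0 // sqr_ge0.
- by move=> i; exact: (mcolM (@mcol_cst R k (d i)) (@mcol_sqr_coord k i)).
rewrite -sumEFin; apply: lee_sum => i _.
rewrite gEZ //; [|by move=> v; exact: sqr_ge0|exact: mcol_sqr_coord].
by rewrite -[leRHS]mule1 lee_pmul // ?lee_fin ?gE_sqr_coord_le // gE_ge0 // => v; exact: sqr_ge0.
Qed.

Lemma gE_qform_le k (M : 'M[R]_k) : psdmx M -> (gE (qform M) <= (\tr M)%:E)%E.
Proof.
move=> pM; have [U [d [iO ME d0]]] := psdmx_spectrum pM.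
rewrite -(gE_isometry iO); [|exact: (proj2 pM)|exact: mcol_qform].
rewrite ME mxtrace_orthogonal ?(proj1 iO) //.
rewrite (_ : (fun v => _) = (fun v : 'cV[R]_k => \sum_i d ord0 i * v i ord0 ^+ 2)).
  exact: gE_sum_sqr_le.
by apply/funext => v; rewrite qform_orthogonal // (proj1 iO).
Qed.

(* Jensen's inequality with the missing weight [1 - \sum_i d i] put at 0,
   from the tangent line of [expR] at the barycenter. *)
Lemma expR_barycenter (I : finType) (d y : I -> R) : (forall i, 0 <= d i) -> \sum_i d i <= 1 ->
  expR (\sum_i d i * y i) <= \sum_i d i * expR (y i) + (1 - \sum_i d i).
Proof.
move=> d0 d1; set m := \sum_i d i * y i.
have tangent z : expR m * (1 + (z - m)) <= expR z.
  have -> : expR z = expR m * expR (z - m) by rewrite -expRD addrCA subrr addr0.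
  by rewrite ler_wpM2l ?expR_ge0 // expR_ge1Dx.
have h0 := tangent 0; rewrite expR0 in h0.
have h1 : \sum_i d i * (expR m * (1 + (y i - m))) <= \sum_i d i * expR (y i).
  by apply: ler_sum => i _; rewrite ler_wpM2l.
have h2 : \sum_i d i * (expR m * (1 + (y i - m))) = expR m * (\sum_i d i * (1 - m) + m).
  rewrite mulrDr mulr_sumr {2 3}/m [X in _ = _ + X]mulr_sumr -big_split /=.
  by apply: eq_bigr => i _; rewrite -/m; ring.
rewrite h2 -mulr_suml in h1; nra.
Qed.

(** In an eigenbasis the form is a combination of squares with nonnegative weights of sum at most 1.
    Convexity of the exponential reduces to one square, of expectation 2; the missing weight carries
    the value 1. *)
Lemma gE_exp_qform_le k (M : 'M[R]_k) : psdmx M -> \tr M <= 1 ->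
  (gE (fun v => expR (3 / 8 * qform M v))%R <= 2%:E)%E.
Proof.
move=> pM trM; have [U [d [iO ME d0]]] := psdmx_spectrum pM.
have mM : mcol (fun v => expR (3 / 8 * qform M v)).
  by apply: (mcol_compR (@measurable_expRmR R)); apply: mcolM;
    [exact: mcol_cst|exact: mcol_qform].
have sd : \sum_i d ord0 i <= 1 by rewrite -(mxtrace_orthogonal _ (proj1 iO)) -ME.
have me i : mcol (fun v : 'cV[R]_k => expR (3 / 8 * v i ord0 ^+ 2)).
  by apply: (mcol_compR (@measurable_expRmR R)); apply: mcolM;
    [exact: mcol_cst|exact: mcol_sqr_coord].
have mde i : mcol (fun v : 'cV[R]_k => d ord0 i * expR (3 / 8 * v i ord0 ^+ 2)).
  by apply: mcolM; [exact: mcol_cst|exact: me].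
rewrite -(gE_isometry iO (fun v => expR_ge0 _) mM).
apply: (@le_trans _ _ (gE (fun v : 'cV[R]_k =>
    \sum_i d ord0 i * expR (3 / 8 * v i ord0 ^+ 2) + (1 - \sum_i d ord0 i)))).
  apply: le_gE => //.
  - exact: (mcol_mulmx U mM).
  - by apply: mcolD; [exact: mcol_sum|exact: mcol_cst].
  - move=> v; rewrite ME qform_orthogonal ?(proj1 iO) // mulr_sumr.
    under eq_bigr do rewrite mulrCA.
    exact: expR_barycenter.
rewrite gED; last 4 first.
- by move=> v; apply: sumr_ge0 => i _; rewrite mulr_ge0 // expR_ge0.
- exact: mcol_sum.
- by move=> v; rewrite subr_ge0.
- exact: mcol_cst.
rewrite gE_cst ?subr_ge0 // gE_sum; last 2 first.
- by move=> i v; rewrite mulr_ge0 // expR_ge0.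
- exact: mde.
rewrite (eq_bigr (fun i => (d ord0 i * 2)%:E)); last first.
  move=> i _; rewrite (gEZ (d0 i) (fun v => expR_ge0 _) (me i)).
  rewrite (@gE_coord _ _ i (fun x => expR (3 / 8 * x ^+ 2))) ?integral_phi_exp38 //.
  - apply: measurableT_comp; first exact: measurable_expRmR.
    by apply: measurable_funM => //; exact: exprn_measurable.
by rewrite sumEFin -EFinD lee_fin -mulr_suml; lra.
Qed.

(** The constant [c] absorbs the coordinates that have already been fixed in an induction on [k]. *)
Definition absquad k (a : 'rV[R]_k) (c : R) (v : 'cV[R]_k) : R :=
  `|c + \sum_i a ord0 i * v i ord0 ^+ 2|.

Lemma absquad_ge0 k (a : 'rV[R]_k) c v : 0 <= absquad a c v.
Proof. exact: normr_ge0. Qed.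

Lemma mcol_absquad k (a : 'rV[R]_k) c : mcol (absquad a c).
Proof.
apply: (mcol_compR (@measurable_normrmR R)); apply: mcolD; first exact: mcol_cst.
by apply: mcol_sum => i; apply: mcolM; [exact: mcol_cst|exact: mcol_sqr_coord].
Qed.

Lemma absquad_cons k (a0 : 'M[R]_1) (a : 'rV[R]_k) c x v :
  absquad (row_mx a0 a) c (col_mx (x%:M : 'M[R]_1) v) = absquad a (c + a0 ord0 ord0 * x ^+ 2) v.
Proof.
rewrite /absquad big_split_ord /= big_ord1 row_mxEl col_mxEu mxE eqxx mulr1n addrA ord1.
by congr `|_ + _|; apply: eq_bigr => i _; rewrite row_mxEr col_mxEd.
Qed.

Lemma gE_absquad_cons k (a0 : 'M[R]_1) (a : 'rV[R]_k) c :
  gE (absquad (row_mx a0 a) c) =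
  (\int[leb]_x ((phi x)%:E * gE (absquad a (c + a0 ord0 ord0 * x ^+ 2))))%E.
Proof.
rewrite gES; [|exact: absquad_ge0|exact: mcol_absquad].
apply: eq_integral => x _; congr (_ * gE _)%E; apply/funext => v.
exact: absquad_cons.
Qed.

Lemma measurable_gE_absquad k (a0 : 'M[R]_1) (a : 'rV[R]_k) c :
  measurable_fun setT ((fun x => (phi x)%:E * gE (absquad a (c + a0 ord0 ord0 * x ^+ 2)))%E :
    mR -> \bar R).
Proof.
have := measurable_gE_cons (@absquad_ge0 _ (row_mx a0 a) c) (mcol_absquad (row_mx a0 a) c).
congr (measurable_fun _ _); apply/funext => x; congr (_ * gE _)%E; apply/funext => v.
exact: absquad_cons.
Qed.

(** Finiteness is what makes [fine] harmless in [gauss_abs_quad]. *)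
Lemma gE_absquad_fin k (a : 'rV[R]_k) : (gE (absquad a 0) <= (\sum_i `|a ord0 i|)%:E)%E.
Proof.
apply: le_trans (gE_sum_sqr_le (fun i => normr_ge0 (a ord0 i))).
apply: le_gE; [exact: absquad_ge0|exact: mcol_absquad| |].
  by apply: mcol_sum => i; apply: mcolM; [exact: mcol_cst|exact: mcol_sqr_coord].
move=> v; rewrite /absquad add0r; apply: le_trans (ler_norm_sum _ _ _) _.
by apply: ler_sum => i _; rewrite normrM [X in _ * X]ger0_norm // sqr_ge0.
Qed.

Lemma gE_absquad_triangle k (a : 'rV[R]_k) c c' :
  ((`|c - c'|)%:E <= gE (absquad a c) + gE (absquad a c'))%E.
Proof.
rewrite -(gE_cst k (normr_ge0 (c - c'))) -gED; try exact: absquad_ge0; try exact: mcol_absquad.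
apply: le_gE => //; [exact: mcol_cst|by apply: mcolD; exact: mcol_absquad|].
move=> v; rewrite /absquad; set s := \sum_i _.
by rewrite (_ : c - c' = (c + s) - (c' + s)) ?ler_normB //; ring.
Qed.

(* The mean over [x] is compared with its translate by 2; only [0 <= x <= 1]
   is used in the last step, where [phi x], [phi (x + 2)] are at least [phi 3]. *)
Lemma gE_absquad_head k (a0 : 'M[R]_1) (a : 'rV[R]_k) c :
  ((2 * phi 3 * `|a0 ord0 ord0|)%:E <= gE (absquad (row_mx a0 a) c))%E.
Proof.
rewrite gE_absquad_cons; set al := a0 ord0 ord0.
pose h x := gE (absquad a (c + al * x ^+ 2)).
have h0 x : (0 <= h x)%E by apply: gE_ge0; exact: absquad_ge0.
pose H x := ((phi x)%:E * h x)%E.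
have H0 x : (0 <= H x)%E by rewrite mule_ge0 // lee_fin phi_ge0.
have mH : measurable_fun setT (H : mR -> \bar R) by exact: measurable_gE_absquad.
have phi_le x y : `|x| <= `|y| -> phi y <= phi x.
  move=> xy; rewrite !phiE ler_wpM2l ?normal_peak_ge0 // ler_expR !mulNr lerN2.
  by rewrite ler_wpM2r // -[x ^+ 2]real_normK ?num_real // -[y ^+ 2]real_normK ?num_real //
    lerXn2r ?nnegrE.
have ms : measurable_fun setT ((fun x => H (x + 2)) : mR -> \bar R).
  by apply: measurableT_comp => //; exact: measurable_funD.
have main : ((4 * phi 3 * `|al|)%:E <= \int[leb]_x (H x) + \int[leb]_x (H x))%E.
  rewrite -{2}(@lebesgue_shift _ H 2) // -ge0_integralD //.
  rewrite -[leLHS]mule1 -[X in (_ * X)%E](_ : leb `[0, 1]%classic = 1%E); last first.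
    by rewrite lebesgue_measure_itv /= lte01 oppr0 adde0.
  rewrite -integral_cst //.
  apply: (@le_trans _ _ (\int[leb]_(x in `[0%R, 1%R]) (H x + H (x + 2)%R))%E).
    apply: ge0_le_integral => //.
    - by move=> x _; rewrite lee_fin !mulr_ge0 // phi_ge0.
    - apply: measurable_funTS; exact: emeasurable_funD.
    - move=> x /=; rewrite in_itv /= => /andP[x0 x1].
      have p1 : phi 3 <= phi x by apply: phi_le; rewrite !ger0_norm //; lra.
      have p2 : phi 3 <= phi (x + 2) by apply: phi_le; rewrite !ger0_norm //; lra.
      apply: (@le_trans _ _ ((phi 3)%:E * h x + (phi 3)%:E * h (x + 2)%R)%E); last first.
        by apply: leeD; rewrite lee_wpmul2r // lee_fin.
      rewrite -ge0_muleDr // (_ : 4 * phi 3 * _ = phi 3 * (4 * `|al|)); last by ring.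
      rewrite EFinM lee_wpmul2l ?lee_fin ?phi_ge0 //.
      apply: le_trans (gE_absquad_triangle _ _ _).
      (* (x + 2)^2 - x^2 = 4 x + 4 is at least 4 on [0, 1]: this is the 4 in [main]. *)
      rewrite (_ : _ - _ = al * - (4 * x + 4)); last by ring.
      by rewrite lee_fin normrM normrN mulrC ler_wpM2l // ger0_norm; lra.
  apply: ge0_subset_integral => //.
  - exact: emeasurable_funD.
  - by move=> x _; rewrite adde_ge0.
have I0 : (0 <= \int[leb]_x H x)%E by apply: integral_ge0.
move: main I0; rewrite -/H; case: (\int[leb]_x H x)%E => [r| |] //= + _.
  by rewrite -EFinD !lee_fin; lra.
by move=> _; rewrite leey.
Qed.

(** The bound is uniform in [c], so for a later coordinate it can be averaged over the first one. It
    keeps the infimum in [vartheta] away from 0. *)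
Lemma gE_absquad_lb k (a : 'rV[R]_k) c (i : 'I_k) :
  ((2 * phi 3 * `|a ord0 i|)%:E <= gE (absquad a c))%E.
Proof.
elim: k a c i => [? ? [] //|k ih] a c i.
rewrite -[a]/(a : 'rV[R]_(1 + k)) -[a in absquad a](@hsubmxK _ 1 1 k a).
case: (split_ordP (i : 'I_(1 + k))) => j ij.
  have := gE_absquad_head (lsubmx (a : 'rV_(1 + k))) (rsubmx (a : 'rV_(1 + k))) c.
  by rewrite mxE [j]ord1 in ij *; rewrite ij ord1.
rewrite gE_absquad_cons.
rewrite -[leLHS](@integral_phi_cst R); last by rewrite lee_fin !mulr_ge0 // phi_ge0.
apply: ge0_le_integral => //.
- by move=> x _; rewrite mule_ge0 ?lee_fin ?phi_ge0 // !mulr_ge0 // phi_ge0.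
- apply: emeasurable_funM => //; apply/measurable_EFinP; exact: measurable_phi.
- exact: measurable_gE_absquad.
- move=> x _; rewrite lee_wpmul2l ?lee_fin ?phi_ge0 //.
  by have := ih (rsubmx (a : 'rV_(1 + k))) (c + lsubmx (a : 'rV_(1 + k)) ord0 ord0 * x ^+ 2) j;
    rewrite mxE ij.
Qed.

(** The expectation of [absquad], as iterated integrals along a list of coefficients. On lists,
    zeros can be filtered out and different numbers of variables compared. *)
Fixpoint iterated_absquad (s : seq R) (c : R) : \bar R :=
  if s is a :: s' then (\int[leb]_x ((phi x)%:E * iterated_absquad s' (c + a * x ^+ 2)%R))%E
  else `|c|%:E.

Lemma iterated_absquad_ge0 s c : (0 <= iterated_absquad s c)%E.
Proof.
elim: s c => [|a s ih] c /=; first by rewrite lee_fin.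
by apply: integral_ge0 => x _; rewrite mule_ge0 // lee_fin phi_ge0.
Qed.

Lemma iterated_absquad_filter s c : iterated_absquad [seq a <- s | a != 0] c = iterated_absquad s c.
Proof.
elim: s c => [|a s ih] c //=; case: eqVneq => [->|_] /=.
  under [RHS]eq_integral do rewrite mul0r addr0.
  by rewrite integral_phi_cst ?iterated_absquad_ge0.
by apply: eq_integral => x _; rewrite ih.
Qed.

Lemma gE_absquadE k (a : 'rV[R]_k) c : gE (absquad a c) =
  iterated_absquad [seq a ord0 i | i <- enum 'I_k] c.
Proof.
elim: k a c => [|k ih] a c.
  rewrite (_ : enum _ = [::]) /=; last by apply: size0nil; rewrite size_enum_ord.
  rewrite -(@gE_cst R 0 `|c|) //; congr gE; apply/funext => v.
  by rewrite /absquad big_ord0 addr0.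
rewrite enum_ordSl /= -[a in absquad a](@hsubmxK _ 1 1 k a) gE_absquad_cons.
apply: eq_integral => x _; rewrite ih mxE; congr (_ * iterated_absquad _ (_ + a _ _ * _))%E.
- rewrite -map_comp; apply: eq_map => i /=; rewrite mxE; congr (a _ _); exact/val_inj.
- exact/val_inj.
Qed.

End GaussianQuadraticForms.

(** * The constant [vartheta] *)

Section Vartheta.
Variable R : realType.
Local Notation phi := (normal_pdf (0 : R) 1).

Lemma normal_peak1 k : (2 * pi : R) `^ (- (k%:R / 2)) = normal_peak 1 ^+ k.
Proof.
have -> : normal_peak 1 = (2 * pi : R) `^ (- 2^-1).
  rewrite powRN powR12_sqrt ?mulr_ge0 ?pi_ge0 // /normal_peak expr1n mul1r.
  by congr (Num.sqrt _)^-1; rewrite mulr2n; ring.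
by rewrite -powR_mulrn ?powR_ge0 // -powRrM; congr (_ `^ _); field.
Qed.

Lemma gE_absquad_finE k (a : 'rV[R]_k) : gE (absquad a 0) = (fine (gE (absquad a 0)))%:E.
Proof.
rewrite fineK // ge0_fin_numE; last by apply: gE_ge0; exact: absquad_ge0.
by apply: le_lt_trans (gE_absquad_fin a) _; rewrite ltry.
Qed.

Lemma gauss_abs_quadE k (a : 'rV[R]_k) : gauss_abs_quad a = fine (gE (absquad a 0)).
Proof.
have p0 : 0 < normal_peak (1 : R) by apply: normal_peak_gt0; exact: oner_neq0.
rewrite /gauss_abs_quad normal_peak1 -lebkE.
pose f (v : 'cV[R]_k) := absquad a 0 v * expR (- qform 1%:M v / 2).
have f0 v : 0 <= f v by rewrite mulr_ge0 ?absquad_ge0 ?expR_ge0.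
have mf : mcol f.
  apply: mcolM; first exact: mcol_absquad.
  apply: (mcol_compR (@measurable_expRmR R)); apply: mcolM; last exact: mcol_cst.
  rewrite (_ : (fun v => _) = qform (- 1%:M)); first exact: mcol_qform.
  by apply/funext => v; rewrite qform_oppmx.
have -> : gE (absquad a 0) = ((normal_peak 1 ^+ k)%:E * Lint f)%E.
  rewrite /gE /Lint -ge0_integralZl ?lee_fin ?exprn_ge0 ?(ltW p0) //.
  - by apply: eq_integral => u _; rewrite -EFinM; congr EFin; rewrite /gpdf /f mulrCA.
  - by apply/measurable_EFinP.
  - by move=> u _; rewrite lee_fin.
rewrite (_ : Lint f = (\int[lebesgue_sigma_finite R k]_u
    (`| \sum_i a ord0 i * (tnth u i : R) ^+ 2 | *
     expR (- (\sum_i (tnth u i : R) ^+ 2) / 2))%:E)%E); last first.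
  apply: eq_integral => u _; rewrite /f /absquad add0r qform1.
  by congr (`| _ | * expR (- _ / 2))%:E; apply: eq_bigr => i _; rewrite mxE.
set I := (\int[_]_u _)%E.
have : (0 <= I)%E by apply: integral_ge0 => u _; rewrite lee_fin mulr_ge0 ?expR_ge0.
case: I => [r| |] //= _.
(* For an infinite integral both sides would be 0, the default value of [fine]. *)
by rewrite mulr0 gt0_muley // lte_fin exprn_gt0.
Qed.

Lemma normal_pdf_gt0 (x : R) : 0 < phi x.
Proof. by rewrite phiE mulr_gt0 ?expR_gt0 // normal_peak_gt0 // oner_neq0. Qed.

Lemma gauss_abs_quad_lb k (a : 'rV[R]_k) i : 2 * phi 3 * `|a ord0 i| <= gauss_abs_quad a.
Proof. by rewrite gauss_abs_quadE -lee_fin -gE_absquad_finE; exact: gE_absquad_lb. Qed.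

Local Notation values k := [set gauss_abs_quad a | a in [set a : 'rV[R]_k | \sum_i `|a ord0 i| =
  1]].

(** Some coefficient has modulus at least 1 / k, and [gauss_abs_quad_lb] applies to it. *)
Lemma gauss_values_lb k : (0 < k)%N -> lbound (values k) (2 * phi 3 / k%:R).
Proof.
move=> k0 _ [a /= a1 <-]; rewrite leNgt; apply/negP => ak.
have : \sum_(i < k) (2 * phi 3 * `|a ord0 i|) < \sum_(i < k) (2 * phi 3 / k%:R).
  apply: ltr_sum => [|i _]; first by apply/hasP; exists (Ordinal k0) => //;
    rewrite mem_index_enum.
  exact: le_lt_trans (gauss_abs_quad_lb a i) ak.
rewrite -mulr_sumr a1 mulr1 sumr_const card_ord -[X in _ < X]mulr_natr divfK ?ltxx //.
by rewrite pnatr_eq0 -lt0n.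
Qed.

Lemma gauss_values_nonempty k : (0 < k)%N -> values k !=set0.
Proof.
move=> k0; pose a : 'rV[R]_k := delta_mx ord0 (Ordinal k0).
exists (gauss_abs_quad a), a => //=; rewrite (bigD1 (Ordinal k0)) //= big1.
  by rewrite mxE !eqxx normr1 addr0.
by move=> i i0; rewrite mxE (negbTE i0) andbF normr0.
Qed.

Lemma vartheta_gt0 k : (0 < k)%N -> 0 < vartheta R k.
Proof.
move=> k0; rewrite /vartheta invr_gt0.
apply: (@lt_le_trans _ _ (2 * phi 3 / k%:R)).
  by rewrite !mulr_gt0 ?normal_pdf_gt0 // invr_gt0 ltr0n.
by apply: lb_le_inf; [exact: gauss_values_nonempty|exact: gauss_values_lb].
Qed.

Lemma gE_absquad_scale k (c : R) (a : 'rV[R]_k) : 0 <= c ->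
  gE (absquad (c *: a) 0) = (c%:E * gE (absquad a 0))%E.
Proof.
move=> c0; rewrite -gEZ //; [|exact: absquad_ge0|exact: mcol_absquad].
congr gE; apply/funext => v; rewrite /absquad !add0r.
rewrite [RHS](_ : _ = `|c * \sum_i a ord0 i * v i ord0 ^+ 2|); last first.
  by rewrite normrM ger0_norm.
rewrite mulr_sumr; congr `|_|.
by apply: eq_bigr => i _; rewrite mxE mulrA.
Qed.

Lemma sum_abs_le_vartheta_same k (a : 'rV[R]_k) : (0 < k)%N ->
  ((\sum_i `|a ord0 i|)%:E <= (vartheta R k)%:E * gE (absquad a 0))%E.
Proof.
move=> k0; set s := \sum_i _.
have s0 : 0 <= s by apply: sumr_ge0.
have t0 := vartheta_gt0 k0.
have [->|sn0] := eqVneq s 0.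
  by rewrite mule_ge0 ?lee_fin ?(ltW t0) // gE_ge0 //; exact: absquad_ge0.
have sp : 0 < s by rewrite lt_neqAle eq_sym sn0.
have h : inf (values k) <= gauss_abs_quad (s^-1 *: a).
  apply: ge_inf; first by exists (2 * phi 3 / k%:R); exact: gauss_values_lb.
  exists (s^-1 *: a) => //=.
  under eq_bigr do rewrite mxE normrM.
  by rewrite -mulr_sumr ger0_norm ?invr_ge0 // mulVf.
rewrite gE_absquad_finE -EFinM lee_fin.
have := h; rewrite gauss_abs_quadE gE_absquad_scale ?invr_ge0 // gE_absquad_finE -EFinM /=.
have i0 : 0 < inf (values k) by move: t0; rewrite /vartheta invr_gt0.
by rewrite mulrC ler_pdivlMr // => {}h; rewrite /vartheta mulrC ler_pdivlMr // mulrC.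
Qed.

(* Zero coefficients do not matter, so that the number of variables may be
   changed to any [k] that is at least the number of nonzero coefficients. *)
Lemma sum_abs_le_vartheta n k (a : 'rV[R]_n) : (0 < k)%N -> (#|[pred i | a ord0 i != 0%R]| <=
  k)%N ->
  ((\sum_i `|a ord0 i|)%:E <= (vartheta R k)%:E * gE (absquad a 0))%E.
Proof.
move=> k0 ak.
pose s := [seq c <- [seq a ord0 i | i <- enum 'I_n] | c != 0].
have ss : (size s <= k)%N.
  apply: leq_trans ak; rewrite /s size_filter count_map -sum1_count big_enum_cond -sum1_card.
  by rewrite (eq_bigl [pred i | a ord0 i != 0]).
(* The nonzero coefficients, padded to length [k] by the default 0 of [nth]. *)
pose b : 'rV[R]_k := \row_i nth 0 s i.
have bE : [seq b ord0 i | i <- enum 'I_k] = s ++ nseq (k - size s) 0.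
  apply: (@eq_from_nth _ 0); first by rewrite size_map size_enum_ord size_cat size_nseq subnKC.
  move=> i; rewrite size_map size_enum_ord => ik.
  rewrite (nth_map (Ordinal ik)) ?size_enum_ord // mxE nth_enum_ord //.
  rewrite nth_cat nth_nseq; case: ltnP => // si; first by rewrite if_same nth_default.
have sumE m (c : 'rV[R]_m) : \sum_i `|c ord0 i| =
  \sum_(x <- [seq x <- [seq c ord0 i | i <- enum 'I_m] | x != 0]) `|x|.
  rewrite big_filter big_map big_enum_cond /= [RHS]big_mkcond; apply: eq_bigr => i _.
  by case: eqVneq => // ->; rewrite normr0.
have sb : [seq x <- [seq b ord0 i | i <- enum 'I_k] | x != 0] = s.
  rewrite bE filter_cat [X in X ++ _](_ : _ = s); last by rewrite /s filter_id.
  rewrite [X in _ ++ X](_ : _ = [::]) ?cats0 //.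
  by rewrite filter_nseq eqxx.
rewrite sumE -/s -sb -sumE gE_absquadE -iterated_absquad_filter -/s.
rewrite -sb iterated_absquad_filter -gE_absquadE.
exact: sum_abs_le_vartheta_same.
Qed.

End Vartheta.

(** * Semidefinite matrices, traces and domination *)

Section PositiveMatrices.
Variable R : realType.

Lemma mxtrace_outer p (M : 'M[R]_p) x : \tr (M *m (x *m x^T)) = qform M x.
Proof. by rewrite mulmxA mxtrace_mulC mulmxA [_ *m x]mx11_scalar mxtrace_scalar mulr1n. Qed.

Lemma psdmx_outer p (x : 'cV[R]_p) : psdmx (x *m x^T).
Proof.
split; first by rewrite trmx_mul trmxK.
move=> y; rewrite /qform !mulmxA -mulmxA mxE big_ord1.
have -> : (x^T *m y) ord0 ord0 = (y^T *m x) ord0 ord0.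
  by rewrite -[x^T *m y]trmxK trmx_mul trmxK mxE.
by rewrite -expr2 sqr_ge0.
Qed.

Lemma psdmx_scale p a (M : 'M[R]_p) : 0 <= a -> psdmx M -> psdmx (a *: M).
Proof.
move=> a0 [sM M0]; split; first by rewrite linearZ /= sM.
by move=> x; rewrite qform_scalemx mulr_ge0.
Qed.

Lemma psdmx_add p (M N : 'M[R]_p) : psdmx M -> psdmx N -> psdmx (M + N).
Proof.
move=> [sM M0] [sN N0]; split; first by rewrite linearD /= sM sN.
by move=> x; rewrite qform_addmx addr_ge0.
Qed.

Lemma psdmx0 p : psdmx (0 : 'M[R]_p).
Proof. by split => [|x]; rewrite ?trmx0 // /qform mulmx0 mul0mx mxE. Qed.

Lemma psdmx1 p : psdmx (1%:M : 'M[R]_p).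
Proof.
split; first by rewrite trmx1.
by move=> x; rewrite qform1 sumr_ge0 // => i _; exact: sqr_ge0.
Qed.

Lemma psdmx_sum p (I : finType) (F : I -> 'M[R]_p) : (forall i, psdmx (F i)) ->
  psdmx (\sum_i F i).
Proof. by move=> h; elim/big_ind: _ => //; [exact: psdmx0|exact: psdmx_add]. Qed.

Lemma psdmx_factor p (M : 'M[R]_p) : psdmx M -> exists F : 'M[R]_p, M = F *m F^T.
Proof.
move=> /psdmx_spectrum [U [d [_ -> d0]]].
exists (U *m diag_mx (map_mx Num.sqrt d)).
rewrite trmx_mul tr_diag_mx [RHS]mulmxA -[X in _ = X *m _]mulmxA mulmx_diag.
congr (_ *m diag_mx _ *m _); apply/rowP => i.
by rewrite !mxE -expr2 sqr_sqrtr.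
Qed.

Lemma mxtrace_mul_ge0 p (M N : 'M[R]_p) : psdmx M -> psdmx N -> 0 <= \tr (M *m N).
Proof.
move=> /psdmx_factor [F ->] [sN N0].
rewrite -mulmxA mxtrace_mulC; apply: sumr_ge0 => i _.
by rewrite -qform_delta -qform_mulmx.
Qed.

Lemma psdmx_trace_eq0 p (M : 'M[R]_p) : psdmx M -> \tr M = 0 -> M = 0.
Proof.
move=> pM; have [U [d [[UU _] -> d0]]] := psdmx_spectrum pM.
rewrite mxtrace_orthogonal // => /eqP; rewrite psumr_eq0 // => /allP h.
have -> : d = 0.
  by apply/rowP => i; rewrite mxE; have /eqP := h i (mem_index_enum i).
by rewrite (_ : diag_mx 0 = 0) ?mulmx0 ?mul0mx //; exact: linear0.
Qed.

Lemma pdmx_lb p (M : 'M[R]_p) : pdmx M -> exists2 c, 0 < c & forall x, c * qform 1%:M x <=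
  qform M x.
Proof.
move=> [sM M0]; have [U [d [[UU Uf] ME]]] := spectral_decomposition sM.
have d0 i : 0 < d ord0 i.
  have := M0 (U *m delta_mx i ord0); rewrite ME qform_orthogonal // (bigD1 i) //= big1.
    rewrite mxE !eqxx expr1n mulr1 addr0; apply; apply/eqP => h.
    have : U^T *m (U *m delta_mx i ord0) = 0 :> 'cV_p by rewrite h mulmx0.
    rewrite mulmxA UU mul1mx => /matrixP /(_ i ord0); rewrite !mxE !eqxx => /eqP.
    by rewrite oner_eq0.
  by move=> j ji; rewrite mxE (negbTE ji) /= expr0n mulr0.
(* A positive number below every eigenvalue; the added 1 covers dimension 0. *)
pose c := (\sum_i (d ord0 i)^-1 + 1)^-1.
have s0 : 0 < \sum_i (d ord0 i)^-1 + 1 :> R.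
  by rewrite ltr_wpDl ?ltr01 // sumr_ge0 // => i _; rewrite invr_ge0 ltW.
exists c; first by rewrite invr_gt0.
move=> x; have UU' := mulmx1C UU.
rewrite (_ : x = U *m (U^T *m x)); last by rewrite mulmxA UU' mul1mx.
rewrite ME qform_orthogonal // qform_mulmx mulmx1 UU qform1 mulr_sumr.
apply: ler_sum => i _; rewrite ler_wpM2r ?sqr_ge0 //.
rewrite /c -[leRHS]invrK lef_pV2 ?posrE ?invr_gt0 //.
rewrite (bigD1 i) //= -addrA lerDl addr_ge0 // sumr_ge0 // => j _.
by rewrite invr_ge0 ltW.
Qed.

Lemma qform_entry_le p (M : 'M[R]_p) d x : (forall i j, `|M i j| <= d) ->
  `|qform M x| <= d * p%:R * qform 1%:M x.
Proof.
move=> Md; rewrite qform_bform bformE.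
apply: (@le_trans _ _ (\sum_i \sum_j d * ((x i ord0 ^+ 2 + x j ord0 ^+ 2) / 2))).
  apply: le_trans (ler_norm_sum _ _ _) _; apply: ler_sum => i _.
  apply: le_trans (ler_norm_sum _ _ _) _; apply: ler_sum => j _.
  rewrite !normrM mulrAC mulrC ler_pM ?mulr_ge0 //.
  have := sqr_ge0 (`|x i ord0| - `|x j ord0|).
  rewrite -[x i ord0 ^+ 2]real_normK ?num_real // -[x j ord0 ^+ 2]real_normK ?num_real //.
  nra.
rewrite qform1 le_eqVlt; apply/orP; left; apply/eqP.
set s := \sum_i _ ^+ 2.
transitivity (\sum_(i < p) (d / 2 * (p%:R * x i ord0 ^+ 2 + s))).
  apply: eq_bigr => i _; rewrite /s mulrDr mulr_sumr.
  rewrite (_ : d / 2 * (p%:R * x i ord0 ^+ 2) = \sum_(j < p) d / 2 * x i ord0 ^+ 2); last first.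
    by rewrite sumr_const card_ord -mulr_natl; ring.
  by rewrite -big_split /=; apply: eq_bigr => j _; field.
rewrite -mulr_sumr big_split /= -mulr_sumr -/s sumr_const card_ord -mulr_natl.
by field.
Qed.

Definition dominates p (H M : 'M[R]_p) : Prop := H^T = H /\ forall x, `|qform M x| <= qform H x.

Lemma dominates_psdmx p (H M : 'M[R]_p) : dominates H M -> psdmx H.
Proof. by move=> [sH HM]; split => // x; apply: le_trans (HM x). Qed.

Lemma dominates_orthogonal p (U : 'M[R]_p) (d : 'rV[R]_p) : U^T *m U = 1%:M ->
  dominates (U *m diag_mx (map_mx Num.norm d) *m U^T) (U *m diag_mx d *m U^T).
Proof.
move=> UU; split; first by rewrite !trmx_mul trmxK tr_diag_mx mulmxA.
move=> x; have UU' := mulmx1C UU.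
rewrite (_ : x = U *m (U^T *m x)); last by rewrite mulmxA UU' mul1mx.
rewrite !qform_orthogonal //; apply: le_trans (ler_norm_sum _ _ _) _.
by apply: ler_sum => i _; rewrite normrM [map_mx _ _ _ _]mxE (ger0_norm (sqr_ge0 _)).
Qed.

Lemma dominates_exists p (M : 'M[R]_p) : M^T = M -> exists H, dominates H M.
Proof.
move=> /spectral_decomposition [U [d [[UU _] ->]]].
by eexists; exact: dominates_orthogonal.
Qed.

Lemma dominates_convex p (H H' M : 'M[R]_p) t : 0 <= t <= 1 ->
  dominates H M -> dominates H' M -> dominates (t *: H + (1 - t) *: H') M.
Proof.
move=> /andP[t0 t1] [sH HM] [sH' HM']; split.
  by rewrite linearD /= !linearZ /= sH sH'.
by move=> x; rewrite qform_addmx !qform_scalemx; have := HM x; have := HM' x; nra.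
Qed.

End PositiveMatrices.

(** * Conic duality by separation *)

Section Duality.
Variable R : realType.

Lemma mxvec_dot m n (A B : 'M[R]_(m, n)) :
  \sum_k mxvec A ord0 k * mxvec B ord0 k = \tr (A^T *m B).
Proof.
transitivity (\sum_p A p.1 p.2 * B p.1 p.2).
  by rewrite (reindex _ (curry_mxvec_bij _ _)) /=; apply: eq_bigr => -[i j] _; rewrite !mxvecE.
rewrite -(pair_bigA _ (fun i j => A i j * B i j)) exchange_big.
by apply: eq_bigr => j _; rewrite mxE; apply: eq_bigr => i _; rewrite mxE.
Qed.

Lemma mxtrace_sub p (A B : 'M[R]_p) : \tr (A - B) = \tr A - \tr B.
Proof. exact: linearB. Qed.

(** Only symmetric perturbations are tested, so the matrix of the separating functional may be
    symmetrized. *)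
Lemma mxtrace_sym_part p (M D : 'M[R]_p) : D^T = D ->
  \tr (2^-1 *: (M + M^T) *m D) = \tr (M^T *m D).
Proof.
move=> sD; rewrite -scalemxAl mxtraceZ mulmxDl mxtraceD.
rewrite (_ : \tr (M *m D) = \tr (M^T *m D)); first by field.
by rewrite -mxtrace_tr trmx_mul sD mxtrace_mulC.
Qed.

(** The tool for reading off signs: a parameter of the separation inequality is sent to infinity. *)
Lemma affine_lt_contra (a b e : R) : 0 < e -> (forall r, 0 <= r -> e <= a + r * b) -> 0 <= b.
Proof.
move=> e0 h; rewrite leNgt; apply/negP => b0.
have := h 0; rewrite lexx mul0r addr0 => /(_ isT) ea.
have := h (- a / b); rewrite divfK ?lt_eqF // subrr.
have -> : 0 <= - a / b by rewrite mulNr oppr_ge0 mulr_ge0_le0 ?invr_le0 ?(ltW b0) //; lra.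
by move=> /(_ isT); lra.
Qed.

(** The properties of the parameter set of an ellitope that duality uses, in a form stable under
    products. *)
Record constraint_set (J : nat) (TT : set 'rV[R]_J) : Prop := ConstraintSet {
  cs_nneg : forall t, TT t -> forall j, 0 <= t ord0 j ;
  cs_convex : forall x y t, TT x -> TT y -> 0 <= t <= 1 -> TT (t *: x + (1 - t) *: y) ;
  (* closedness, in the form needed by [convex_separation] *)
  cs_far : forall x, ~ TT x -> exists2 d, 0 < d &
    forall y, TT y -> exists j, d <= `|y ord0 j - x ord0 j| ;
  cs_bounded : exists b, forall t, TT t -> forall j, t ord0 j <= b ;
  cs_pos : exists2 c, 0 < c & TT (const_mx c) ;
  cs_monotone : monotone_set TT }.

(** A functional separating [m] from the set can be replaced by its negative part: by monotonicity
    the coordinates of [t] where [v] is nonnegative may be set to 0, and [m] is nonnegative. *)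
Lemma constraint_set_polar J (TT : set 'rV[R]_J) (m : 'rV[R]_J) : constraint_set TT ->
  (forall j, 0 <= m ord0 j) ->
  (forall e, 0 < e -> forall lam : 'rV[R]_J, (forall j, 0 <= lam ord0 j) ->
    ~ (forall t, TT t -> \sum_j lam ord0 j * t ord0 j <= \sum_j lam ord0 j * m ord0 j - e)) ->
  TT m.
Proof.
move=> cs m0 h; apply: contrapT => mTT.
have [d d0 far] := cs_far cs mTT.
have [v [e [e0 ve]]] := convex_separation d0 (cs_convex cs) far.
pose lam : 'rV[R]_J := \row_j Num.max (- v ord0 j) 0.
apply: (h e e0 lam) => [j|t Tt]; first by rewrite mxE le_max lexx orbT.
pose t' : 'rV[R]_J := \row_j if v ord0 j < 0 then t ord0 j else 0.
have Tt' : TT t'.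
  have t0 := cs_nneg cs Tt; apply: (cs_monotone cs) Tt => j.
  by rewrite mxE; case: ifP => _; rewrite ?t0 lexx.
have := ve _ Tt'.
have -> : \sum_j v ord0 j * t' ord0 j = - \sum_j lam ord0 j * t ord0 j.
  rewrite -sumrN; apply: eq_bigr => j _; rewrite !mxE; case: ltP => vj.
    by rewrite max_l ?mulNr ?opprK // oppr_ge0 ltW.
  by rewrite max_r ?mulr0 ?mul0r ?oppr0 // oppr_le0.
have : - \sum_j lam ord0 j * m ord0 j <= \sum_j v ord0 j * m ord0 j.
  rewrite -sumrN; apply: ler_sum => j _; rewrite mxE -mulNr ler_wpM2r //.
  by rewrite lerNl le_max lexx.
lra.
Qed.

Section Conic.
Variables (N J S : nat) (Y : 'I_J -> 'M[R]_N) (TT : set 'rV[R]_J) (Xi : 'I_S -> 'M[R]_N).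
Hypothesis cs : constraint_set TT.
Hypothesis hY : forall j, psdmx (Y j).
Hypothesis hYpd : pdmx (\sum_j Y j).
Hypothesis hXi : forall s, (Xi s)^T = Xi s.

(** [D] is the slack allowed in the matrix inequality. The last clause bounds the support function
    of [TT] at [lam] without taking a supremum. *)
Definition conic_feasible (C : R) (D : 'M[R]_N) (lam : 'rV[R]_J) (Th : 'I_S -> 'M[R]_N) : Prop :=
  [/\ forall j, 0 <= lam ord0 j, forall s, dominates (Th s) (Xi s),
      forall x, \sum_s qform (Th s) x <= \sum_j lam ord0 j * qform (Y j) x + qform D x &
      forall t, TT t -> \sum_j lam ord0 j * t ord0 j <= C].

(** The slacks in the matrix inequality and in the objective under which the problem is feasible.
    Flattening them into one row makes [convex_separation] applicable. *)
Definition perturbations (C : R) : set 'rV[R]_(N * N + 1) :=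
  [set w | exists D d, [/\ D^T = D, w = row_mx (mxvec D) d%:M &
     exists lam Th, conic_feasible (C + d) D lam Th]].

Lemma perturbations_convex C x y t : perturbations C x -> perturbations C y ->
  0 <= t <= 1 -> perturbations C (t *: x + (1 - t) *: y).
Proof.
move=> [D [d [sD -> [lam [Th [l0 hT hD hl]]]]]] [D' [d' [sD' ->
  [lam' [Th' [l0' hT' hD' hl']]]]]] t01.
have /andP[t0 t1] := t01; have t1' : 0 <= 1 - t by lra.
exists (t *: D + (1 - t) *: D'), (t * d + (1 - t) * d'); split.
- by rewrite linearD /= !linearZ /= sD sD'.
- by rewrite !scale_row_mx add_row_mx linearD /= !linearZ /= !scale_scalar_mx scalar_mxDE.
exists (t *: lam + (1 - t) *: lam'), (fun s => t *: Th s + (1 - t) *: Th' s); split.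
- by move=> j; rewrite !mxE addr_ge0 // mulr_ge0.
- by move=> s; exact: dominates_convex.
- move=> x0; under eq_bigr do rewrite qform_addmx !qform_scalemx.
  rewrite big_split /= -!mulr_sumr qform_addmx !qform_scalemx.
  under eq_bigr do rewrite !mxE mulrDl -!mulrA.
  rewrite big_split /= -!mulr_sumr.
  have h1 := ler_wpM2l t0 (hD x0); have h2 := ler_wpM2l t1' (hD' x0); lra.
- move=> u Tu; under eq_bigr do rewrite !mxE mulrDl -!mulrA.
  rewrite big_split /= -!mulr_sumr.
  have h1 := ler_wpM2l t0 (hl u Tu); have h2 := ler_wpM2l t1' (hl' u Tu); lra.
Qed.

(* A small perturbation of the constraints is absorbed by increasing all
   the multipliers, since [\sum_j Y j] is positive definite. *)
Lemma perturbations_far C1 C : C1 < C ->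
  ~ (exists lam Th, conic_feasible C 0 lam Th) ->
  exists2 d, 0 < d & forall w, perturbations C1 w -> exists j, d <= `|w ord0 j - (0 :
    'rV[R]_(N * N + 1)) ord0 j|.
Proof.
move=> C1C nofeas.
have [c c0 hc] := pdmx_lb hYpd.
have [b hb] := cs_bounded cs.
have [cc cc0 Tcc] := cs_pos cs.
(* A slack below [d] is absorbed by adding e = d N / c to each multiplier. This costs at most e J
   |b| in the objective, plus [d] for its own slack, hence d B in total. *)
pose B : R := N%:R / c * (J%:R * `|b|) + 1.
have B0 : 0 < B by rewrite ltr_wpDl ?ltr01 // !mulr_ge0 ?invr_ge0 // ltW.
exists ((C - C1) / B); first by rewrite divr_gt0 // subr_gt0.
set d := (C - C1) / B.
have d0 : 0 < d by rewrite divr_gt0 // subr_gt0.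
move=> w [D [dd [sD wE [lam [Th [l0 hT hD hl]]]]]]; apply: contrapT => nofar.
have small j : `|w ord0 j| < d.
  rewrite ltNge; apply/negP => h; apply: nofar; exists j.
  by rewrite mxE subr0.
have ddd : dd <= d.
  have := small (rshift _ ord0); rewrite wE row_mxEr mxE eqxx mulr1n => h.
  exact: le_trans (ler_norm _) (ltW h).
have Dd i j : `|D i j| <= d.
  by have := small (lshift _ (mxvec_index i j)); rewrite wE row_mxEl mxvecE => /ltW.
pose e := d * N%:R / c.
have e0 : 0 <= e by rewrite /e divr_ge0 ?(ltW c0) // mulr_ge0 ?(ltW d0) ?ler0n.
apply: nofeas; exists (lam + const_mx e), Th; split => //.
- by move=> j; rewrite !mxE addr_ge0.
- move=> x; rewrite [qform 0 x](_ : _ = 0) ?addr0; last by rewrite /qform mulmx0 mul0mx mxE.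
  apply: le_trans (hD x) _; under [leRHS]eq_bigr do rewrite !mxE mulrDl.
  rewrite big_split /= lerD2l -mulr_sumr -qform_summx.
  apply: le_trans (ler_norm _) _; apply: le_trans (qform_entry_le x Dd) _.
  have := ler_wpM2l e0 (hc x); rewrite /e mulrA divfK ?gt_eqF //.
- move=> t Tt; under eq_bigr do rewrite !mxE mulrDl.
  rewrite big_split /= -mulr_sumr.
  have h1 := hl t Tt.
  have h2 : \sum_j t ord0 j <= J%:R * `|b|.
    rewrite -[J in J%:R]card_ord mulr_natl -sumr_const; apply: ler_sum => j _.
    by apply: le_trans (hb _ Tt j) _; exact: ler_norm.
  have h3 := ler_wpM2l e0 h2.
  have h4 : d * B = C - C1 by rewrite /d divfK // gt_eqF.
  have h5 : d * B = e * (J%:R * `|b|) + d by rewrite /B /e mulrDr mulr1 !mulrA.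
  lra.
Qed.

(** By contraposition: infeasibility at [C] separates 0 from the perturbations at the intermediate
    value [C1]. The functional, normalized on the objective slack, is a matrix [Sig] contradicting
    the hypothesis; the gap between [C'] and [C] pays for making [Sig] definite. *)
Lemma conic_duality (C' C : R) : C' < C ->
  (forall (Sig : 'M[R]_N) t, pdmx Sig -> TT t -> (forall j, 0 < t ord0 j) ->
     (forall j, \tr (Sig *m Y j) <= t ord0 j) ->
     exists2 Th, forall s, dominates (Th s) (Xi s) & \sum_s \tr (Sig *m Th s) <= C') ->
  exists lam Th, conic_feasible C 0 lam Th.
Proof.
move=> C'C hyp; apply: contrapT => nofeas.
pose C1 := (C + C') / 2.
have C1C : C1 < C by rewrite /C1; lra.
have C'C1 : C' < C1 by rewrite /C1; lra.
have [d0 d00 far] := perturbations_far C1C nofeas.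
have [v [e [e0 ve]]] := convex_separation d00 (@perturbations_convex C1) far.
have [b hb] := cs_bounded cs.
pose S0 := vec_mx (lsubmx v); pose mu := v ord0 (rshift _ ord0).
pose Sg := 2^-1 *: (S0 + S0^T).
have sSg : Sg^T = Sg by rewrite linearZ /= linearD /= trmxK addrC.
have key (lam : 'rV[R]_J) Th P d : (forall j, 0 <= lam ord0 j) ->
  (forall s, dominates (Th s) (Xi s)) ->
    psdmx P -> (forall t, TT t -> \sum_j lam ord0 j * t ord0 j <= C1 + d) ->
    e <= \tr (Sg *m (\sum_s Th s)) - \sum_j lam ord0 j * \tr (Sg *m Y j) + \tr (Sg *m P) + mu * d.
  move=> l0 hT [sP P0] hl.
  (* The exact defect of the matrix inequality, enlarged by an arbitrary semidefinite [P]. *)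
  pose D := \sum_s Th s - \sum_j lam ord0 j *: Y j + P.
  have sD : D^T = D.
    rewrite /D linearD linearB /= [X in X - _ + _]linear_sum [X in _ - X +
      _]linear_sum /= sP. congr (_ - _ + _).
      by apply: eq_bigr => s _; exact: (proj1 (hT s)).
    by apply: eq_bigr => j _; rewrite linearZ /= (proj1 (hY j)).
  have := ve (row_mx (mxvec D) d%:M).
  rewrite big1 ?add0r; last by move=> j _; rewrite mxE mulr0.
  rewrite big_split_ord /= big_ord1 row_mxEr mxE eqxx mulr1n.
  rewrite (eq_bigr (fun k => mxvec S0 ord0 k * mxvec D ord0 k)); last first.
    by move=> k _; rewrite row_mxEl vec_mxK mxE.
  rewrite mxvec_dot -mxtrace_sym_part // -/Sg -/mu.
  have -> : \tr (Sg *m D) = \tr (Sg *m (\sum_s Th s)) - \sum_j lam ord0 j * \tr (Sg *m Y j) +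
    \tr (Sg *m P).
    rewrite /D mulmxDr mulmxBr mxtraceD mxtrace_sub; congr (_ - _ + _).
    rewrite mulmx_sumr linear_sum /=; apply: eq_bigr => j _.
    by rewrite -scalemxAr mxtraceZ.
  apply; exists D, d; split => //; exists lam, Th; split => // x.
  rewrite /D !qform_addmx qform_oppmx !qform_summx.
  under [in - _]eq_bigr do rewrite qform_scalemx.
  have := P0 x; lra.
have [Th0 hTh0] := @choice _ _ _ (fun s => dominates_exists (hXi s)).
have l00 j : 0 <= (0 : 'rV[R]_J) ord0 j by rewrite mxE.
have zeroS (t : 'rV[R]_J) : \sum_j (0 : 'rV[R]_J) ord0 j * t ord0 j = 0.
  by rewrite big1 // => j _; rewrite mxE mul0r.
have zeroY : \sum_j (0 : 'rV[R]_J) ord0 j * \tr (Sg *m Y j) = 0.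
  by rewrite big1 // => j _; rewrite mxE mul0r.
have mu0 : 0 <= mu.
  apply: (@affine_lt_contra (\tr (Sg *m \sum_s Th0 s) + mu * `|C1|) _ e e0) => r r0.
  have := key 0 Th0 0 (`|C1| + r) l00 hTh0 (psdmx0 _ _).
  rewrite zeroY mulmx0 mxtrace0 subr0 addr0 => h.
  rewrite -addrA -[r * mu]mulrC -mulrDr; apply: h => t _; rewrite zeroS.
  by have := ler_norm (- C1); rewrite normrN; lra.
have pSg : psdmx Sg.
  split => // x.
  apply: (@affine_lt_contra (\tr (Sg *m \sum_s Th0 s) + mu * `|C1|) _ e e0) => r r0.
  have := key 0 Th0 (r *: (x *m x^T)) `|C1| l00 hTh0 (psdmx_scale r0 (psdmx_outer x)).
  rewrite zeroY subr0 -scalemxAr mxtraceZ mxtrace_outer => h.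
  rewrite addrAC; apply: h => t _; rewrite zeroS.
  by have := ler_norm (- C1); rewrite normrN; lra.
(* If mu = 0, the objective is free and all multipliers can grow together. This forces the trace of
   [Sg] against the definite matrix sum_j Y_j to be nonpositive, so [Sg] = 0 and the functional
   vanishes. *)
have mup : 0 < mu.
  rewrite lt_neqAle eq_sym mu0 andbT; apply/negP => /eqP muE.
  have trY : 0 <= - \tr (Sg *m \sum_j Y j).
    apply: (@affine_lt_contra (\tr (Sg *m \sum_s Th0 s)) _ e e0) => r r0.
    have := key (const_mx r) Th0 0 (r * (J%:R * `|b|) + `|C1|) _ hTh0 (psdmx0 _ _).
    rewrite muE mul0r addr0 mulmx0 mxtrace0 addr0 => h.
    rewrite (_ : r * _ = - \sum_j (const_mx r : 'rV[R]_J) ord0 j * \tr (Sg *m Y j)); last first.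
      rewrite mulrN mulmx_sumr linear_sum /= mulr_sumr.
      by congr (- _); apply: eq_bigr => j _; rewrite mxE.
    apply: h => [j|t Tt]; first by rewrite mxE.
    under eq_bigr do rewrite mxE.
    rewrite -mulr_sumr.
    have h2 : \sum_j t ord0 j <= J%:R * `|b|.
      rewrite -[J in J%:R]card_ord mulr_natl -sumr_const; apply: ler_sum => j _.
      by apply: le_trans (hb _ Tt j) _; exact: ler_norm.
    have h3 := ler_wpM2l r0 h2.
    by have := ler_norm (- C1); rewrite normrN; lra.
  have [c c0 hc] := pdmx_lb hYpd.
  have psd' : psdmx (\sum_j Y j - c *: 1%:M).
    split; first by rewrite linearB /= linearZ /= trmx1 (proj1 hYpd).
    by move=> x; rewrite qform_addmx qform_oppmx qform_scalemx subr_ge0.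
  have := mxtrace_mul_ge0 pSg psd'.
  rewrite mulmxBr -scalemxAr mulmx1 mxtrace_sub mxtraceZ => h.
  have tr0 : 0 <= \tr Sg by have := mxtrace_mul_ge0 pSg (psdmx1 _ _); rewrite mulmx1.
  have trE : \tr Sg = 0.
    apply/eqP; rewrite eq_le tr0 andbT -(pmulr_rle0 _ c0); lra.
  have := key 0 Th0 0 `|C1| l00 hTh0 (psdmx0 _ _).
  rewrite (psdmx_trace_eq0 pSg trE) muE !mul0mx !mxtrace0 mul0r addr0 big1; last first.
    by move=> j _; rewrite mul0mx mxtrace0 mulr0.
  rewrite subr0 addr0 => h2; suff : e <= 0 by lra.
  apply: h2 => t _; rewrite zeroS.
  by have := ler_norm (- C1); rewrite normrN; lra.
pose Sig := mu^-1 *: Sg; pose e' := e / mu.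
have e'0 : 0 < e' by rewrite divr_gt0.
have pSig : psdmx Sig by apply: psdmx_scale; rewrite ?invr_ge0.
have key2 (lam : 'rV[R]_J) Th d : (forall j, 0 <= lam ord0 j) ->
  (forall s, dominates (Th s) (Xi s)) ->
    (forall t, TT t -> \sum_j lam ord0 j * t ord0 j <= C1 + d) ->
    e' <= \tr (Sig *m (\sum_s Th s)) - \sum_j lam ord0 j * \tr (Sig *m Y j) + d.
  move=> l0 hT hl; have := key lam Th 0 d l0 hT (psdmx0 _ _) hl.
  rewrite mulmx0 mxtrace0 addr0 /e' ler_pdivrMr // => h.
  rewrite mulrDl mulrBl /Sig -scalemxAl mxtraceZ mulrAC mulVf ?mul1r ?gt_eqF //.
  rewrite mulr_suml (eq_bigr (fun j => lam ord0 j * \tr (Sg *m Y j)));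
    first by rewrite [d * _]mulrC.
  by move=> j _; rewrite -scalemxAl mxtraceZ; field; rewrite gt_eqF.
pose m : 'rV[R]_J := \row_j \tr (Sig *m Y j).
have m0 j : 0 <= m ord0 j by rewrite mxE mxtrace_mul_ge0.
(* If a nonnegative [lam] cut [m] off from [TT] by [e2], then scaling it by r would leave a
   right-hand side in [key2] decreasing like - r e2. *)
have TTm : TT m.
  apply: constraint_set_polar cs m0 _ => e2 e20 lam l0 hl.
  suff : 0 <= - e2 by lra.
  apply: (@affine_lt_contra (\tr (Sig *m \sum_s Th0 s) - C1) _ e' e'0) => r r0.
  have := key2 (r *: lam) Th0 (r * (\sum_j lam ord0 j * m ord0 j - e2) - C1) _ hTh0.
  rewrite (_ : \sum_j (r *: lam) ord0 j * \tr (Sig *m Y j) = r * \sum_j lam ord0 j * m ord0 j);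
    last first.
    by rewrite mulr_sumr; apply: eq_bigr => j _; rewrite !mxE mulrA.
  move=> h.
  rewrite (_ : _ - _ + _ = \tr (Sig *m \sum_s Th0 s) - r * (\sum_j lam ord0 j * m ord0 j) +
     (r * (\sum_j lam ord0 j * m ord0 j - e2) - C1)); last by ring.
  apply: h => [j|t Tt]; first by rewrite mxE mulr_ge0.
  rewrite addrCA subrr addr0.
  rewrite (_ : \sum_j (r *: lam) ord0 j * t ord0 j = r * \sum_j lam ord0 j * t ord0 j);
    last first.
    by rewrite mulr_sumr; apply: eq_bigr => j _; rewrite !mxE mulrA.
  by rewrite ler_wpM2l // hl.
have key3 Th : (forall s, dominates (Th s) (Xi s)) -> C1 + e' <= \tr (Sig *m (\sum_s Th s)).
  move=> hT; have := key2 0 Th (- C1) l00 hT.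
  rewrite (_ : \sum_j (0 : 'rV[R]_J) ord0 j * \tr (Sig *m Y j) = 0) ?subr0; last first.
    by rewrite big1 // => j _; rewrite mxE mul0r.
  move=> h; rewrite -lerBrDl; apply: h => t _.
  by rewrite zeroS subrr.
have [c c0 Tc] := cs_pos cs.
(* Small enough for the traces of kap Y_j to stay below the constant vector [c] of [TT]. *)
pose kap := c / (\sum_j \tr (Y j) + 1).
have trY0 j : 0 <= \tr (Y j) by have := mxtrace_mul_ge0 (psdmx1 _ _) (hY j); rewrite mul1mx.
have sY0 : 0 < \sum_j \tr (Y j) + 1 by rewrite ltr_wpDl ?ltr01 // sumr_ge0.
have kap0 : 0 < kap by rewrite divr_gt0.
have kapY j : kap * \tr (Y j) <= c.
  rewrite /kap mulrAC ler_pdivrMr // ler_pM2l // (bigD1 j) //= -addrA lerDl.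
  by rewrite addr_ge0 // sumr_ge0.
(* The hypothesis wants a definite matrix and positive bounds: [Sig] is mixed with the identity, and
   [m] with the constant vector [c], in the same proportion. *)
have bound eta : 0 < eta -> eta < 1 -> (1 - eta) * (C1 + e') <= C'.
  move=> eta0 eta1.
  pose Sig' := (1 - eta) *: Sig + (eta * kap) *: 1%:M.
  pose t : 'rV[R]_J := (1 - eta) *: m + (1 - (1 - eta)) *: const_mx c.
  have trE M : \tr (Sig' *m M) = (1 - eta) * \tr (Sig *m M) + eta * kap * \tr M.
    by rewrite /Sig' mulmxDl -!scalemxAl mul1mx mxtraceD !mxtraceZ.
  have ek : 0 < eta * kap by rewrite mulr_gt0.
  have [||||Th hTh ThC'] := hyp Sig' t.
  - split.
      apply: (proj1 (psdmx_add (psdmx_scale _ pSig) (psdmx_scale (ltW ek) (psdmx1 _ _)))); lra.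
    move=> x x0; rewrite qform_addmx (qform_scalemx _ Sig) (qform_scalemx _ 1%:M) ltr_wpDl //.
      by apply: mulr_ge0; [lra|exact: (proj2 pSig)].
    by rewrite mulr_gt0 // qform1_gt0.
  - by apply: (cs_convex cs) => //; lra.
  - move=> j; rewrite !mxE ltr_wpDl //; last by rewrite mulr_gt0 //; lra.
    by rewrite mulr_ge0 //; [lra|have := m0 j; rewrite mxE].
  - move=> j; rewrite trE !mxE lerD2l -mulrA opprB addrCA subrr addr0.
    by rewrite ler_wpM2l // ltW.
  apply: le_trans ThC'; under eq_bigr do rewrite trE.
  rewrite big_split /= -!mulr_sumr -linear_sum /= -mulmx_sumr.
  apply: (@le_trans _ _ ((1 - eta) * \tr (Sig *m \sum_s Th s))).
    by rewrite ler_wpM2l ?key3 //; lra.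
  rewrite lerDl mulr_ge0 ?(ltW ek) // sumr_ge0 // => s _.
  by have := mxtrace_mul_ge0 (psdmx1 _ _) (dominates_psdmx (hTh s)); rewrite mul1mx.
set X := C1 + e' in bound.
have XC' : C' < X by rewrite /X; lra.
(* Chosen so that eta |X| < X - C', hence (1 - eta) X > C'. *)
pose eta := (X - C') / (2 * (`|X| + (X - C'))).
have den : 0 < 2 * (`|X| + (X - C')) by have := normr_ge0 X; lra.
have etaE : eta * (2 * (`|X| + (X - C'))) = X - C' by rewrite /eta divfK // gt_eqF.
have eta0 : 0 < eta by rewrite divr_gt0 // subr_gt0.
have eta1 : eta < 1 by rewrite /eta ltr_pdivrMr //; have := normr_ge0 X; lra.
have := bound _ eta0 eta1.
have : eta * X <= eta * `|X| by rewrite ler_wpM2l ?(ltW eta0) // ler_norm.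
have : 0 < eta * (X - C') by rewrite mulr_gt0 // subr_gt0.
nra.
Qed.

End Conic.
End Duality.

(** * Dominating matrices of small trace and Gaussian maxima *)

Section Rounding.
Variable R : realType.

Lemma convex_setP n (T : set 'rV[R]_n) : convex_set T ->
  forall x y t, T x -> T y -> 0 <= t <= 1 -> T (t *: x + (1 - t) *: y).
Proof.
move=> cT x y t Tx Ty t01.
have [t0 t1] := andP t01.
have h := cT x y (Itv01 t0 t1); rewrite !inE in h.
exact: h.
Qed.

Lemma ellitope_constraint_set p K (Tm : 'I_K -> 'M[R]_p) (T : set 'rV[R]_K) :
  ellitope_data Tm T -> constraint_set T.
Proof.
move=> [K0 _ _ Tn Tc Tcomp Ti Tmono]; split => //.
- exact: convex_setP.
- move=> x Tx; have Tcl : closed T by apply: compact_closed Tcomp; exact: norm_hausdorff.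
  have /nbhs_ballP[e /= e0 eT] : nbhs x (~` T).
    by apply: open_nbhs_nbhs; split => //; rewrite openC.
  exists e => // y Ty; apply: contrapT => h; apply: (eT y _ Ty); split => // i j.
  rewrite ord1 /ball /= distrC ltNge; apply/negP => hj; apply: h; by exists j.
- have [M [_ hM]] := compact_bounded Tcomp.
  exists (M + 1) => t Tt j.
  have := hM (M + 1); rewrite ltrDl ltr01 => /(_ isT t Tt) /=.
  apply: le_trans; apply: le_trans (ler_norm _) _.
  by rewrite [leRHS]/Num.norm /= mx_normrE; apply/bigmax_geP; right => /=; exists (ord0, j).
- have [x Tx] := Ti; have /nbhs_ballP[e /= e0 eT] := Tx.
  have Tx' := Tn x (eT x (ballxx x e0)).
  exists (e / 2); first by rewrite divr_gt0.
  have Txe : T (x + const_mx (e / 2)).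
    apply: eT; split => // i j; rewrite /ball /= !mxE opprD addNKr normrN gtr0_norm ?divr_gt0 //.
    by rewrite ltr_pdivrMr // ltr_pMr // ltr1n.
  apply: Tmono Txe => j; rewrite !mxE lerDr Tx' andbT.
  by rewrite ltW // divr_gt0.
Qed.

Definition set_pair J K (TT : set 'rV[R]_J) (UU : set 'rV[R]_K) : set 'rV[R]_(J + K) :=
  [set t | TT (lsubmx t) /\ UU (rsubmx t)].

Lemma constraint_set_pair J K (TT : set 'rV[R]_J) (UU : set 'rV[R]_K) :
  constraint_set TT -> constraint_set UU -> constraint_set (set_pair TT UU).
Proof.
move=> cT cU; split.
- move=> t [Tt Ut] j; case: (split_ordP j) => i ->.
    by have := cs_nneg cT Tt i; rewrite mxE.
  by have := cs_nneg cU Ut i; rewrite mxE.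
- move=> x y t [Tx Ux] [Ty Uy] t01; split.
    by rewrite linearD /= !linearZ /=; exact: (cs_convex cT).
  by rewrite linearD /= !linearZ /=; exact: (cs_convex cU).
- move=> x; rewrite /set_pair /= => /not_andP[h|h].
    have [d d0 far] := cs_far cT h; exists d => // y [Ty _].
    by have [j] := far _ Ty; rewrite !mxE; exists (lshift _ j).
  have [d d0 far] := cs_far cU h; exists d => // y [_ Ty].
  by have [j] := far _ Ty; rewrite !mxE; exists (rshift _ j).
- have [b hb] := cs_bounded cT; have [c hc] := cs_bounded cU.
  exists (Num.max b c) => t [Tt Ut] j; rewrite le_max.
  case: (split_ordP j) => i ->.
    by have := hb _ Tt i; rewrite mxE => ->.
  by have := hc _ Ut i; rewrite mxE => ->; rewrite orbT.
- have [b b0 hb] := cs_pos cT; have [c c0 hc] := cs_pos cU.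
  exists (Num.min b c); first by rewrite lt_min b0.
  split.
    apply: (cs_monotone cT) hb => k; rewrite !mxE le_min ge_min lexx (ltW b0) (ltW c0) //.
  by apply: (cs_monotone cU) hc => k; rewrite !mxE le_min ge_min lexx (ltW b0) (ltW c0) orbT.
- move=> t t' h [Tt' Ut']; split.
    by apply: (cs_monotone cT) Tt' => k; rewrite !mxE.
  by apply: (cs_monotone cU) Ut' => k; rewrite !mxE.
Qed.

(** [M] selects the nonzero coordinates and [L] divides by them, so [diag_mx a] factors an identity
    matrix of that size. *)
Lemma card_nonzero_le_rank n (a : 'rV[R]_n) : (#|[pred i | a ord0 i != 0%R]| <=
  \rank (diag_mx a))%N.
Proof.
pose A := [pred i | a ord0 i != 0%R]; pose f (i : 'I_#|A|) : 'I_n := enum_val i.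
pose M : 'M[R]_(#|A|, n) := \matrix_(i, j) (f i == j)%:R.
pose L : 'M[R]_(n, #|A|) := \matrix_(j, i) ((f i == j)%:R / a ord0 j).
apply: (@mulmx1_min_rank _ _ _ _ _ M L).
apply/matrixP => i j; rewrite mul_mx_diag !mxE (bigD1 (f i)) //= big1.
  rewrite !mxE eqxx addr0 mul1r (inj_eq enum_val_inj) [j == i]eq_sym.
  case: eqVneq => _; last by rewrite mul0r mulr0.
  by rewrite mul1r divff //; have := enum_valP i.
by move=> k ki; rewrite !mxE eq_sym (negbTE ki) !mul0r.
Qed.

Lemma pdmx_factor N (M : 'M[R]_N) : pdmx M -> exists F G : 'M[R]_N,
  [/\ M = F *m F^T, F *m G = 1%:M & G *m F = 1%:M].
Proof.
move=> [sM M0].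
have pM : psdmx M.
  split => // x; have [->|/M0/ltW //] := eqVneq x 0.
  by rewrite /qform mulmx0 mxE.
have [F ME] := psdmx_factor pM.
have Fu : F \in unitmx.
  rewrite unitmxE unitfE; apply/negP => /det0P [v v0 vF].
  have : 0 < qform M v^T.
    by apply: M0; apply: contra v0 => /eqP h; rewrite -[v]trmxK h trmx0.
  by rewrite /qform trmxK ME mulmxA vF !mul0mx mxE ltxx.
exists F, (invmx F); split => //; [exact: mulmxV|exact: mulVmx].
Qed.

(* In an orthonormal eigenbasis of [F^T X F] the quadratic form becomes [\sum_i a_i v_i^2],
  and at most [k] of
   the [a_i] are nonzero. *)
Lemma dominating_trace N k (X Sig F G : 'M[R]_N) : X^T = X -> Sig = F *m F^T ->
  F *m G = 1%:M -> G *m F = 1%:M -> (0 < k)%N -> (\rank X <= k)%N ->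
  exists2 H, dominates H X &
    ((\tr (Sig *m H))%:E <= (vartheta R k)%:E * gE (fun v => `|qform X (F *m v)|%R))%E.
Proof.
move=> sX SigE FG GF k0 rX.
have sXF : (F^T *m X *m F)^T = F^T *m X *m F by rewrite !trmx_mul trmxK sX mulmxA.
have [U [a [iU XE]]] := spectral_decomposition sXF.
have UU := proj1 iU; have UU' := mulmx1C UU.
pose W := U *m diag_mx (map_mx Num.norm a) *m U^T.
have [sW WX] := dominates_orthogonal a UU; rewrite -/W -XE in sW WX.
(* [W] is the modulus of [F^T X F]; conjugation by G = F^-1 turns it into a matrix dominating
   [X]. *)
exists (G^T *m W *m G).
  split; first by rewrite trmx_mul (trmx_mul G^T W) trmxK sW mulmxA.
  move=> x; have -> : qform X x = qform (F^T *m X *m F) (G *m x).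
    by rewrite -qform_mulmx mulmxA FG mul1mx.
  by rewrite -(qform_mulmx W G); exact: WX.
have -> : \tr (Sig *m (G^T *m W *m G)) = \sum_i `|a ord0 i|.
  rewrite SigE -!mulmxA mxtrace_mulC -!mulmxA GF mulmx1 !mulmxA -trmx_mul GF trmx1 mul1mx.
  rewrite mxtrace_orthogonal //; apply: eq_bigr => i _; by rewrite mxE.
have mf : mcol (fun v => `|qform X (F *m v)|).
  apply: (mcol_compR (@measurable_normrmR R)); apply: (mcol_mulmx F).
  exact: mcol_qform.
rewrite -(gE_isometry iU (fun v => normr_ge0 _) mf).
have -> : (fun v => `|qform X (F *m (U *m v))|) = absquad a 0.
  apply/funext => v; rewrite /absquad add0r qform_mulmx XE qform_orthogonal //.
apply: sum_abs_le_vartheta => //.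
apply: leq_trans (card_nonzero_le_rank a) _.
have -> : diag_mx a = U^T *m (F^T *m X *m F) *m U.
  by rewrite XE !mulmxA UU mul1mx -mulmxA UU mulmx1.
apply: leq_trans (mxrankM_maxl _ _) _; apply: leq_trans (mxrankM_maxr _ _) _.
by apply: leq_trans (mxrankM_maxl _ _) _; apply: leq_trans (mxrankM_maxr _ _) rX.
Qed.

(** From exp (-1/2) >= 1/2 follows exp (1/2) <= 2, so e <= 4. The threshold 4 is 2 K at K = 2. *)
Lemma ln_ge1 (x : R) : 4 <= x -> 1 <= ln x.
Proof.
move=> x4; rewrite -[leLHS]expRK ler_ln ?posrE ?expR_gt0 //; last by lra.
apply: le_trans x4; have h := expR_ge1Dx (- (1 / 2) : R).
rewrite (_ : 1 = 1 / 2 + 1 / 2 :> R); last by field.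
have h2 : expR (1 / 2) <= 2 :> R.
  have e0 := expR_gt0 (1 / 2 : R).
  have : expR (1 / 2) * expR (- (1 / 2)) = 1 :> R by rewrite -expRD subrr expR0.
  nra.
rewrite expRD; have := expR_gt0 (1 / 2 : R); nra.
Qed.

(** A measurable majorant replaces the maximum. With A = 2 K, the inequality 1 + y <= exp y at y =
    3/8 u - ln A gives u <= 8/3 (exp (3/8 u) / A + ln A - 1). Summed over the forms, the
    exponentials have expectation at most A, so the total is 8/3 ln A. For K = 1 the form itself
    serves, with expectation at most its trace. *)
Lemma max_qform_moment N K (D : 'I_K -> 'M[R]_N) : (0 < K)%N ->
  (forall k, psdmx (D k)) -> (forall k, \tr (D k) <= 1) ->
  exists a : 'cV[R]_N -> R, [/\ mcol a, forall v, 0 <= a v,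
    forall k v, qform (D k) v <= a v & (gE a <= (varkappa R K ^+ 2)%:E)%E].
Proof.
move=> K0 pD trD; rewrite /varkappa; case: ltnP => K1; last first.
  have KE : K = 1%N by apply/eqP; rewrite eqn_leq K1.
  subst K; exists (qform (D ord0)); split.
  - exact: mcol_qform.
  - exact: (proj2 (pD _)).
  - by move=> k v; rewrite ord1.
  - by apply: le_trans (gE_qform_le (pD _)) _; rewrite expr1n lee_fin.
pose A : R := (2 * K)%N%:R.
have A4 : 4 <= A by rewrite ler_nat (@leq_mul 2 2).
have lnA := ln_ge1 A4.
have A0 : 0 < A by lra.
have ei k : mcol (fun v => expR (3 / 8 * qform (D k) v)).
  by apply: (mcol_compR (@measurable_expRmR R)); apply: mcolM;
    [exact: mcol_cst|exact: mcol_qform].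
have es : mcol (fun v => \sum_k expR (3 / 8 * qform (D k) v)) by exact: mcol_sum.
exists (fun v => 8 / 3 / A * (\sum_k expR (3 / 8 * qform (D k) v)) + 8 / 3 * (ln A - 1)); split.
- by apply: mcolD; [apply: mcolM => //|]; exact: mcol_cst.
- move=> v; rewrite addr_ge0 // mulr_ge0 //; try lra.
    by rewrite !mulr_ge0 // invr_ge0 ltW.
  by apply: sumr_ge0 => k _; exact: expR_ge0.
- move=> k v; set u := qform _ _.
  have h1 : expR (3 / 8 * u) <= \sum_k expR (3 / 8 * qform (D k) v).
    by rewrite (bigD1 k) //= lerDl sumr_ge0 // => i _; exact: expR_ge0.
  have h2 := expR_ge1Dx (3 / 8 * u - ln A).
  rewrite expRD expRN lnK ?posrE // in h2.
  have h3 : expR (3 / 8 * u) / A <= (\sum_k expR (3 / 8 * qform (D k) v)) / A.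
    by rewrite ler_wpM2r // invr_ge0 ltW.
  rewrite (_ : 8 / 3 / A * _ = 8 / 3 * ((\sum_k expR (3 / 8 * qform (D k) v)) / A)); first by lra.
  by rewrite mulrAC -mulrA.
- rewrite gED; last 4 first.
  + move=> v; rewrite !mulr_ge0 ?invr_ge0 ?(ltW A0) //; apply: sumr_ge0 => k _; exact: expR_ge0.
  + by apply: mcolM => //; exact: mcol_cst.
  + by move=> v; rewrite mulr_ge0 //; lra.
  + exact: mcol_cst.
  rewrite gE_cst; last by rewrite mulr_ge0 //; lra.
  rewrite gEZ //; last 2 first.
  + by rewrite !mulr_ge0 // invr_ge0 ltW.
  + by move=> v; apply: sumr_ge0 => k _; exact: expR_ge0.
  apply: (@le_trans _ _ ((8 / 3 / A)%:E * A%:E + (8 / 3 * (ln A - 1))%:E)%E).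
    rewrite leeD2r // lee_wpmul2l //; first by rewrite lee_fin !mulr_ge0 // invr_ge0 ltW.
    rewrite gE_sum //.
    apply: (@le_trans _ _ (\sum_(k < K) 2%:E)%E).
      by apply: lee_sum => k _; apply: gE_exp_qform_le.
    by rewrite sumEFin lee_fin sumr_const card_ord /A natrM mulr_natr.
  rewrite -EFinM -EFinD lee_fin exprMn sqr_sqrtr; last by lra.
  rewrite divfK ?gt_eqF //; lra.
Qed.

End Rounding.

(** * From Gaussian rounding to a feasible solution *)

Section Relaxation.
Variable R : realType.

Lemma qform_block p q (A : 'M[R]_p) (B : 'M[R]_(p, q)) C (D : 'M[R]_q) x y :
  qform (block_mx A B C D) (col_mx x y) = qform A x + bform B x y + bform C y x + qform D y.
Proof.
rewrite /qform /bform tr_col_mx mul_row_block mul_row_col !mulmxDl !mxE.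
by ring.
Qed.

Lemma bform0 p q (x : 'cV[R]_p) (y : 'cV[R]_q) : bform 0 x y = 0.
Proof. by rewrite /bform mulmx0 mul0mx mxE. Qed.

Lemma bform0r p q (M : 'M[R]_(p, q)) (x : 'cV[R]_p) : bform M x 0 = 0.
Proof. by rewrite /bform mulmx0 mxE. Qed.

Lemma bform0l p q (M : 'M[R]_(p, q)) (y : 'cV[R]_q) : bform M 0 y = 0.
Proof. by rewrite /bform trmx0 !mul0mx mxE. Qed.

Definition offdiag p q (M : 'M[R]_(q, p)) : 'M[R]_(q + p) :=
  block_mx 0 (2^-1 *: M) (2^-1 *: M^T) 0.

Lemma offdiag_sym p q (M : 'M[R]_(q, p)) : (offdiag M)^T = offdiag M.
Proof. by rewrite /offdiag tr_block_mx !trmx0 !linearZ /= trmxK. Qed.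

Lemma qform_offdiag p q (M : 'M[R]_(q, p)) z w : qform (offdiag M) (col_mx z w) = bform M z w.
Proof.
by rewrite qform_block !qform_bform !bform0 !bform_scalemx bform_tr; field.
Qed.

Lemma rank_offdiag p q (M : 'M[R]_(q, p)) : (\rank (offdiag M) <= 2 * \rank M)%N.
Proof.
have -> : offdiag M = block_mx (2^-1 *: M) 0 0 (2^-1 *: M^T) *m block_mx 0 1%:M 1%:M 0.
  by rewrite mulmx_block !(mulmx0, mul0mx, mulmx1, addr0, add0r).
apply: leq_trans (mxrankM_maxl _ _) _; rewrite rank_diag_block_mx mul2n -addnn.
by apply: leq_add; apply: leq_trans (mxrank_scale _ _) _; rewrite ?mxrank_tr.
Qed.

Lemma varkappa_gt0 J : 0 < varkappa R J.
Proof.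
rewrite /varkappa; case: ltnP => // J1; rewrite mulr_gt0 //.
rewrite sqrtr_gt0; apply: (@lt_le_trans _ _ 1) => //; apply: ln_ge1.
by rewrite ler_nat (@leq_mul 2 2).
Qed.

Section Core.
Variables (p q K L S kappa : nat).
Variables (Tm : 'I_K -> 'M[R]_p) (T : set 'rV[R]_K).
Variables (Rm : 'I_L -> 'M[R]_q) (RR : set 'rV[R]_L).
Variable (M : 'I_S -> 'M[R]_(q, p)).
Hypotheses (hT : ellitope_data Tm T) (hR : ellitope_data Rm RR).
Variable N0 : R.
Hypothesis N00 : 0 <= N0.
Hypothesis hN : forall z w, basic_ellitope Rm RR z -> basic_ellitope Tm T w ->
  \sum_s `|bform (M s) z w| <= N0.

(** By homogeneity the sum is at most N0 sqrt (a b), and sqrt (a b) <= (c a + b / c) / 2. The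
    right-hand side is linear in [a] and [b], so its expectation needs only theirs. As [a] or [b]
    may be 0, the rescaling uses larger positive numbers. *)
Lemma sum_bform_bound t r a b c z w : T t -> RR r -> 0 <= a -> 0 <= b -> 0 < c ->
  (forall k, qform (Tm k) w <= a * t ord0 k) -> (forall l, qform (Rm l) z <= b * r ord0 l) ->
  \sum_s `|bform (M s) z w| <= N0 * ((c * a + b / c) / 2).
Proof.
move=> Tt Rr a0 b0 c0 ha hb.
have pos a' b' : a < a' -> b < b' ->
    \sum_s `|bform (M s) z w| <= N0 * ((c * a' + b' / c) / 2).
  move=> aa bb; have a'0 := le_lt_trans a0 aa; have b'0 := le_lt_trans b0 bb.
  pose sa := Num.sqrt a'; pose sb := Num.sqrt b'.
  have sa0 : 0 < sa by rewrite sqrtr_gt0.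
  have sb0 : 0 < sb by rewrite sqrtr_gt0.
  have saE : sa ^+ 2 = a' by rewrite sqr_sqrtr // ltW.
  have sbE : sb ^+ 2 = b' by rewrite sqr_sqrtr // ltW.
  have Ww : basic_ellitope Tm T (sa^-1 *: w).
    exists t => // k; rewrite qformZ exprVn saE mulrC ler_pdivrMr // mulrC.
    by apply: le_trans (ha k) _; rewrite ler_wpM2r ?(ell_nneg hT Tt) // ltW.
  have Zz : basic_ellitope Rm RR (sb^-1 *: z).
    exists r => // l; rewrite qformZ exprVn sbE mulrC ler_pdivrMr // mulrC.
    by apply: le_trans (hb l) _; rewrite ler_wpM2r ?(ell_nneg hR Rr) // ltW.
  have := hN Zz Ww.
  have -> : \sum_s `|bform (M s) (sb^-1 *: z) (sa^-1 *: w)| =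
    (\sum_s `|bform (M s) z w|) / (sa * sb).
    rewrite mulr_suml; apply: eq_bigr => s _.
    have sai : 0 < sa^-1 by rewrite invr_gt0.
    have sbi : 0 < sb^-1 by rewrite invr_gt0.
    rewrite bformZl bformZr !normrM (gtr0_norm sai) (gtr0_norm sbi) invfM; ring.
  rewrite ler_pdivrMr ?mulr_gt0 // => h; apply: le_trans h _.
  rewrite ler_wpM2l // -saE -sbE ler_pdivlMr // -subr_ge0.
  rewrite (_ : _ - _ = (c * sa - sb) ^+ 2 / c); last by field; rewrite gt_eqF.
  by rewrite divr_ge0 ?sqr_ge0 // ltW.
apply/ler_addgt0Pl => e e0.
(* Raising [a] and [b] by [d] costs d (B - 1), less than e = d B. *)
pose B := N0 * ((c + c^-1) / 2) + 1.
have ci0 : 0 < c^-1 by rewrite invr_gt0.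
have B0 : 0 < B by rewrite ltr_wpDl ?ltr01 // mulr_ge0 //; lra.
pose d := e / B; have d0 : 0 < d by rewrite divr_gt0.
have dB : d * B = e by rewrite /d divfK // gt_eqF.
have := pos (a + d) (b + d); rewrite !ltrDl d0 => /(_ isT isT) h; apply: le_trans h _.
rewrite -dB /B -subr_ge0 (_ : _ - _ = d); first by rewrite ltW.
by field; rewrite gt_eqF.
Qed.

(** Both ellitopes are described by forms on the pair (z, w), so that a single duality statement
    with the product of [RR] and [T] covers them. *)
Definition joint_mx (j : 'I_(L + K)) : 'M[R]_(q + p) :=
  match fintype.split j with
  | inl l => block_mx (Rm l) 0 0 0
  | inr k => block_mx 0 0 0 (Tm k)
  end.

Lemma joint_mxl l : joint_mx (lshift K l) = block_mx (Rm l) 0 0 0.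
Proof. by rewrite /joint_mx (unsplitK (inl l)). Qed.

Lemma joint_mxr k : joint_mx (rshift L k) = block_mx 0 0 0 (Tm k).
Proof. by rewrite /joint_mx (unsplitK (inr k)). Qed.

Lemma qform_jointl l z w : qform (joint_mx (lshift K l)) (col_mx z w) = qform (Rm l) z.
Proof. by rewrite joint_mxl qform_block !bform0 [qform 0 w]bform0 !addr0. Qed.

Lemma qform_jointr k z w : qform (joint_mx (rshift L k)) (col_mx z w) = qform (Tm k) w.
Proof. by rewrite joint_mxr qform_block !bform0 [qform 0 z]bform0 !add0r. Qed.

Lemma joint_psd j : psdmx (joint_mx j).
Proof.
split.
  case: (split_ordP j) => i ->.
    by rewrite joint_mxl tr_block_mx !trmx0 (proj1 (ell_psd hR i)).
  by rewrite joint_mxr tr_block_mx !trmx0 (proj1 (ell_psd hT i)).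
move=> x; rewrite -[x]vsubmxK; case: (split_ordP j) => i ->.
  by rewrite qform_jointl; exact: (proj2 (ell_psd hR i)).
by rewrite qform_jointr; exact: (proj2 (ell_psd hT i)).
Qed.

Lemma joint_sum_pd : pdmx (\sum_j joint_mx j).
Proof.
split; first exact: (proj1 (psdmx_sum joint_psd)).
move=> x x0; rewrite qform_summx -[x]vsubmxK big_split_ord /=.
under eq_bigr do rewrite qform_jointl.
under [X in _ + X]eq_bigr do rewrite qform_jointr.
rewrite -!qform_summx.
have [_ pR] := ell_sum_pd hR; have [_ pT] := ell_sum_pd hT.
have [u0|u0] := eqVneq (usubmx x) 0.
  rewrite u0 [qform _ 0]bform0r add0r pT //; apply: contra x0 => /eqP d0.
  by rewrite -[x]vsubmxK u0 d0 col_mx0.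
have [->|d0] := eqVneq (dsubmx x) 0; first by rewrite [qform _ 0]bform0r addr0 pR.
by rewrite addr_gt0 ?pR ?pT.
Qed.

Hypothesis kappa0 : (0 < kappa)%N.
Hypothesis hrank : forall s, (\rank (M s) <= kappa)%N.

Let bound := varkappa R K * varkappa R L * vartheta R (2 * kappa) * N0.

Lemma rounding (Sig : 'M[R]_(q + p)) (t : 'rV[R]_(L + K)) : pdmx Sig -> set_pair RR T t ->
  (forall j, 0 < t ord0 j) -> (forall j, \tr (Sig *m joint_mx j) <= t ord0 j) ->
  exists2 Th, forall s, dominates (Th s) (offdiag (M s)) & \sum_s \tr (Sig *m Th s) <= bound.
Proof.
move=> pSig [Rr Tt] t0 trt.
have [F [G [SigE FG GF]]] := pdmx_factor pSig.
have k0 : (0 < 2 * kappa)%N by rewrite muln_gt0.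
have dt s : exists H, dominates H (offdiag (M s)) /\
    ((\tr (Sig *m H))%:E <= (vartheta R (2 * kappa))%:E *
       gE (fun v => `|qform (offdiag (M s)) (F *m v)|%R))%E.
  have rk : (\rank (offdiag (M s)) <= 2 * kappa)%N.
    by apply: leq_trans (rank_offdiag _) _; rewrite leq_mul2l hrank orbT.
  by have [H H1 H2] := dominating_trace (offdiag_sym (M s)) SigE FG GF k0 rk; exists H.
have [Th hTh] := @choice _ _ _ dt.
exists Th; first by move=> s; have [] := hTh s.
(* Division by t_j normalizes the trace bound to 1; this is where positivity of [t] is used. *)
pose D j := (t ord0 j)^-1 *: (F^T *m joint_mx j *m F).
have pD j : psdmx (D j).
  apply: psdmx_scale; first by rewrite invr_ge0 ltW.
  split; first by rewrite !trmx_mul trmxK (proj1 (joint_psd j)) mulmxA.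
  by move=> x; rewrite -qform_mulmx; exact: (proj2 (joint_psd j)).
have trD j : \tr (D j) <= 1.
  rewrite /D mxtraceZ mulrC ler_pdivrMr // mul1r; apply: le_trans (trt j).
  by rewrite mxtrace_mulC mulmxA SigE.
have [a [ma a0 ha Ea]] := max_qform_moment (ell_gt0 hT)
  (fun k => pD (rshift L k)) (fun k => trD (rshift L k)).
have [b [mb b0 hb Eb]] := max_qform_moment (ell_gt0 hR)
  (fun l => pD (lshift K l)) (fun l => trD (lshift K l)).
have vK := varkappa_gt0 K; have vL := varkappa_gt0 L.
(* The balanced weight: both terms of (c a + b / c) / 2 then contribute half of the product of the
   two constants. *)
pose c := varkappa R L / varkappa R K.
have c0 : 0 < c by rewrite divr_gt0.
have mform s : mcol (fun v => `|qform (offdiag (M s)) (F *m v)|).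
  apply: (mcol_compR (@measurable_normrmR R)); apply: (mcol_mulmx F); exact: mcol_qform.
have th0 := vartheta_gt0 R k0.
have qD j v : qform (joint_mx j) (F *m v) = qform (D j) v * t ord0 j.
  by rewrite /D qform_scalemx -qform_mulmx mulrAC mulVf ?mul1r // gt_eqF.
have pw v : \sum_s `|qform (offdiag (M s)) (F *m v)| <= N0 * c / 2 * a v + N0 / c / 2 * b v.
  rewrite (_ : _ + _ = N0 * ((c * a v + b v / c) / 2)); last by ring.
  rewrite -[F *m v]vsubmxK; under eq_bigr do rewrite qform_offdiag.
  apply: (sum_bform_bound Tt Rr (a0 v) (b0 v) c0).
  - move=> k; rewrite -(qform_jointr k (usubmx (F *m v))) vsubmxK qD mxE.
    by rewrite ler_wpM2r ?ha // ltW.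
  - move=> l; rewrite -(qform_jointl l _ (dsubmx (F *m v))) vsubmxK qD mxE.
    by rewrite ler_wpM2r ?hb // ltW.
have step1 : ((\sum_s \tr (Sig *m Th s))%:E <=
    (vartheta R (2 * kappa))%:E * gE (fun v => \sum_s `|qform (offdiag (M s)) (F *m v)|)%R)%E.
  rewrite gE_sum // -sumEFin ge0_sume_distrr; last first.
    by move=> s _; apply: gE_ge0.
  by apply: lee_sum => s _; have [] := hTh s.
have ca0 : 0 <= N0 * c / 2 by rewrite divr_ge0 // mulr_ge0 // (ltW c0).
have cb0 : 0 <= N0 / c / 2 by rewrite divr_ge0 // divr_ge0 // (ltW c0).
have step2 : (gE (fun v => \sum_s `|qform (offdiag (M s)) (F *m v)|)%R <=
    (N0 * c / 2)%:E * (varkappa R K ^+ 2)%:E + (N0 / c / 2)%:E * (varkappa R L ^+ 2)%:E)%E.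
  apply: (@le_trans _ _ (gE (fun v => N0 * c / 2 * a v + N0 / c / 2 * b v))).
    apply: le_gE => //; first by move=> v; apply: sumr_ge0.
      exact: mcol_sum.
    by apply: mcolD; apply: mcolM => //; exact: mcol_cst.
  rewrite gED; last 4 first.
  - by move=> v; rewrite mulr_ge0.
  - by apply: mcolM => //; exact: mcol_cst.
  - by move=> v; rewrite mulr_ge0.
  - by apply: mcolM => //; exact: mcol_cst.
  rewrite !gEZ //; apply: leeD; rewrite lee_wpmul2l // lee_fin //.
rewrite -lee_fin; apply: le_trans step1 _.
apply: (@le_trans _ _ ((vartheta R (2 * kappa))%:E *
   ((N0 * c / 2)%:E * (varkappa R K ^+ 2)%:E + (N0 / c / 2)%:E * (varkappa R L ^+ 2)%:E))%E).
  by rewrite lee_wpmul2l // lee_fin ltW.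
rewrite -(EFinM (N0 * c / 2)) -(EFinM (N0 / c / 2)) -EFinD -EFinM lee_fin le_eqVlt; apply/orP;
  left; apply/eqP.
by rewrite /bound /c; field; rewrite !gt_eqF.
Qed.

Lemma ell_nonempty p' K' (Tm' : 'I_K' -> 'M[R]_p') T' : ellitope_data Tm' T' -> T' !=set0.
Proof. by move=> /ell_interior [x /interior_subset]; exists x. Qed.

(** The matrices G_s and H_s are the diagonal blocks of the dominating Th_s, and testing the sum
    constraint on (z, 0) and (0, w) separates the two Loewner bounds. *)
Lemma relaxation_bound C : bound < C ->
  exists (lam : 'rV[R]_K) (ups : 'rV[R]_L) (G : 'I_S -> 'M[R]_q) (H : 'I_S -> 'M[R]_p),
  [/\ (forall k, 0 <= lam ord0 k) /\ (forall l, 0 <= ups ord0 l),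
      (forall s, (G s)^T = G s) /\ (forall s, (H s)^T = H s),
      forall s, psdmx (block_mx (G s) (2^-1 *: M s) (2^-1 *: (M s)^T) (H s)),
      loewner_le (\sum_s G s) (\sum_l ups ord0 l *: Rm l) /\
      loewner_le (\sum_s H s) (\sum_k lam ord0 k *: Tm k) &
      support_fun T lam + support_fun RR ups <= C].
Proof.
move=> hC.
have cs := constraint_set_pair (ellitope_constraint_set hR) (ellitope_constraint_set hT).
have [mu [Th [mu0 hTh hsum hC']]] :=
  conic_duality cs joint_psd joint_sum_pd (fun s => offdiag_sym (M s)) hC rounding.
pose lam := rsubmx mu; pose ups := lsubmx mu.
pose G s := ulsubmx (Th s); pose H s := drsubmx (Th s).
have sG s : (G s)^T = G s by rewrite /G trmx_ulsub (proj1 (hTh s)).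
have sH s : (H s)^T = H s by rewrite /H trmx_drsub (proj1 (hTh s)).
have qTh s z w : qform (Th s) (col_mx z w) =
    qform (G s) z + (bform (ursubmx (Th s)) z w + bform (dlsubmx (Th s)) w z) + qform (H s) w.
  by rewrite -{1}[Th s]submxK qform_block addrA.
have lam0 k : 0 <= lam ord0 k by rewrite mxE.
have ups0 l : 0 <= ups ord0 l by rewrite mxE.
have sumY x y : \sum_j mu ord0 j * qform (joint_mx j) (col_mx x y) =
    qform (\sum_l ups ord0 l *: Rm l) x + qform (\sum_k lam ord0 k *: Tm k) y.
  rewrite big_split_ord /= !qform_summx; congr (_ + _); apply: eq_bigr => i _.
    by rewrite qform_jointl qform_scalemx mxE.
  by rewrite qform_jointr qform_scalemx mxE.
have q0 n (N : 'M[R]_n) : qform N 0 = 0 by exact: bform0r.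
have q0mx n (x : 'cV[R]_n) : qform 0 x = 0 by exact: bform0.
have symsum n m' (c : 'rV[R]_m') (Y : 'I_m' -> 'M[R]_n) : (forall i, psdmx (Y i)) ->
    (\sum_i c ord0 i *: Y i)^T = \sum_i c ord0 i *: Y i.
  move=> pY; rewrite linear_sum /=; apply: eq_bigr => i _.
  by rewrite linearZ /= (proj1 (pY i)).
exists lam, ups, G, H; split => //.
- move=> s; split.
    by rewrite tr_block_mx sG sH !linearZ /= trmxK.
  move=> x; rewrite -[x]vsubmxK; set z := usubmx x; set w := dsubmx x.
  rewrite qform_block !bform_scalemx bform_tr.
  (* Adding the bounds at (z, w) and (z, - w) cancels the off-diagonal blocks of [Th s]. *)
  have h1 := (proj2 (hTh s)) (col_mx z w); have h2 := (proj2 (hTh s)) (col_mx z (- w)).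
  rewrite !qform_offdiag !qTh in h1 h2.
  have hN1 : bform (M s) z (- w) = - bform (M s) z w by rewrite -scaleN1r bformZr mulN1r.
  have hN2 : bform (ursubmx (Th s)) z (- w) =
    - bform (ursubmx (Th s)) z w by rewrite -scaleN1r bformZr mulN1r.
  have hN3 : bform (dlsubmx (Th s)) (- w) z =
    - bform (dlsubmx (Th s)) w z by rewrite -scaleN1r bformZl mulN1r.
  have hN4 : qform (H s) (- w) = qform (H s) w by rewrite -scaleN1r qformZ sqrrN expr1n mul1r.
  rewrite hN1 hN2 hN3 hN4 normrN in h2.
  have := ler_norm (- bform (M s) z w); rewrite normrN; lra.
- split; split.
  + rewrite linearB /= symsum //; last exact: (ell_psd hR).
    by rewrite linear_sum /=; congr (_ - _); apply: eq_bigr => s _.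
  + move=> z; rewrite qform_addmx qform_oppmx subr_ge0 [leLHS]qform_summx.
    have := hsum (col_mx z 0); rewrite sumY q0 q0mx !addr0.
    apply: le_trans; apply: ler_sum => s _.
    by rewrite qTh bform0r bform0l q0 !addr0.
  + rewrite linearB /= symsum //; last exact: (ell_psd hT).
    by rewrite linear_sum /=; congr (_ - _); apply: eq_bigr => s _.
  + move=> w; rewrite qform_addmx qform_oppmx subr_ge0 [leLHS]qform_summx.
    have := hsum (col_mx 0 w); rewrite sumY q0 q0mx add0r addr0.
    apply: le_trans; apply: ler_sum => s _.
    by rewrite qTh bform0r bform0l q0 !add0r.
- have [t1 Tt1] := ell_nonempty hT; have [r1 Rr1] := ell_nonempty hR.
  have val t r : T t -> RR r -> \sum_k lam ord0 k * t ord0 k + \sum_l ups ord0 l * r ord0 l <= C.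
    move=> Tt Rr; have := hC' (row_mx r t).
    rewrite big_split_ord /= addrC => h.
    under eq_bigr do rewrite mxE; under [X in _ + X]eq_bigr do rewrite mxE.
    under eq_bigr do rewrite -(row_mxEr r t); under [X in _ +
      X]eq_bigr do rewrite -(row_mxEl r t).
    by apply: h; split; rewrite ?row_mxKl ?row_mxKr.
  rewrite -lerBrDr; apply: ge_sup; first by exists (\sum_k lam ord0 k * t1 ord0 k), t1.
  move=> _ [t Tt <-]; rewrite lerBrDr -lerBrDl.
  apply: ge_sup; first by exists (\sum_l ups ord0 l * r1 ord0 l), r1.
  by move=> _ [r Rr <-]; rewrite lerBrDl val.
Qed.

End Core.
End Relaxation.

(** * Gauges, operator norms and the final comparison *)

Section Norms.
Variable R : realType.

Lemma support_fun_ge p K (Tm : 'I_K -> 'M[R]_p) T (lam t : 'rV[R]_K) : ellitope_data Tm T ->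
  (forall k, 0 <= lam ord0 k) -> T t -> \sum_k lam ord0 k * t ord0 k <= support_fun T lam.
Proof.
move=> hT l0 Tt; apply: ub_le_sup; last by exists t.
have [b hb] := cs_bounded (ellitope_constraint_set hT).
exists (\sum_k lam ord0 k * b) => _ [u Tu <-].
by apply: ler_sum => k _; rewrite ler_wpM2l // hb.
Qed.

Lemma basic_ellitope0 p K (Tm : 'I_K -> 'M[R]_p) T : ellitope_data Tm T -> basic_ellitope Tm T 0.
Proof.
move=> hT; have [t Tt] := ell_nonempty hT; exists t => // k.
by rewrite [qform _ 0]bform0r (ell_nneg hT).
Qed.

Lemma basic_ellitopeN p K (Tm : 'I_K -> 'M[R]_p) T w : basic_ellitope Tm T w ->
  basic_ellitope Tm T (- w).
Proof.
by move=> [t Tt h]; exists t => // k; rewrite -scaleN1r qformZ sqrrN expr1n mul1r.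
Qed.

Lemma basic_ellitope_mid p K (Tm : 'I_K -> 'M[R]_p) T w w' : ellitope_data Tm T ->
  basic_ellitope Tm T w -> basic_ellitope Tm T w' -> basic_ellitope Tm T (2^-1 *: (w + w')).
Proof.
move=> hT [t Tt h] [t' Tt' h'].
exists (2^-1 *: t + (1 - 2^-1) *: t').
  apply: (cs_convex (ellitope_constraint_set hT)) => //.
  by rewrite invr_ge0 ler0n /= invf_le1 // ler1n.
move=> k; rewrite !mxE qformZ qformD ?(proj1 (ell_psd hT k)) //.
have := (proj2 (ell_psd hT k)) (w - w').
rewrite qformD ?(proj1 (ell_psd hT k)) // -[- w']scaleN1r bformZr qformZ sqrrN expr1n.
have := h k; have := h' k; rewrite exprVn.
set b := bform _ _ _; lra.
Qed.

Section Gauge.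
Variables (n m p q K L S : nat) (P : 'M[R]_(n, p)) (Q : 'M[R]_(m, q)).
Variables (Tm : 'I_K -> 'M[R]_p) (T : set 'rV[R]_K).
Variables (Rm : 'I_L -> 'M[R]_q) (RR : set 'rV[R]_L).
Variable (A : 'I_S -> 'M[R]_(m, n)).
Hypotheses (hT : ellitope_data Tm T) (hR : ellitope_data Rm RR).
Let X := [set P *m w | w in basic_ellitope Tm T].
Let Bstar := [set Q *m z | z in basic_ellitope Rm RR].
Let B := polar Bstar.
Hypothesis hX : X° !=set0.
Let M s := Q^T *m A s *m P.

(** [X] is symmetric and closed under midpoints: if [x0] is interior, then s/2 x is the midpoint of
    x0 + s x and - x0. Hence the gauge is the infimum of a nonempty set. *)
Lemma absorbing x : exists2 r, 0 < r & X (r^-1 *: x).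
Proof.
have [x0 Xx0] := hX; have /nbhs_ballP[e /= e0 eX] := Xx0.
have [w0 Ww0 w0E] : X x0 by apply: eX; exact: ballxx.
(* The step s x stays within sup-norm distance [e], as each |x_i| is below the denominator. *)
pose s := e / (\sum_i `|x i ord0| + 1).
have sx0 : 0 <= \sum_i `|x i ord0| by apply: sumr_ge0.
have s0 : 0 < s by rewrite divr_gt0 //; lra.
have [w1 Ww1 w1E] : X (x0 + s *: x).
  apply: eX; split => // i j; rewrite ord1 /ball /= !mxE opprD addNKr normrN normrM gtr0_norm //.
  rewrite /s mulrAC ltr_pdivrMr ?ltr_pM2l //; last by lra.
  by rewrite (bigD1 i) //= -addrA ltrDl ltr_wpDl // sumr_ge0.
exists (2 / s); first by rewrite divr_gt0.
exists (2^-1 *: (w1 + - w0)); first by apply: basic_ellitope_mid => //; exact: basic_ellitopeN.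
rewrite -scalemxAr mulmxBr w1E w0E addrAC subrr add0r scalerA invfM invrK.
by congr (_ *: _).
Qed.

Lemma gauge_set_lb k (U : set 'cV[R]_k) x : has_lbound [set r : R | 0 < r /\ U (r^-1 *: x)].
Proof. by exists 0 => r [/ltW]. Qed.

Lemma gauge_norm_le1 w : basic_ellitope Tm T w -> gauge_norm X (P *m w) <= 1.
Proof.
move=> Ww; apply: ge_inf; first exact: gauge_set_lb.
by split => //; exists w => //; rewrite invr1 scale1r.
Qed.

Lemma polar_pairing (D : 'M[R]_(m, n)) w z : ((D *m (P *m w))^T *m (Q *m z)) ord0 ord0 =
  bform (Q^T *m D *m P) z w.
Proof. by rewrite -bform_mulmx -[RHS]bform_tr /bform [(D *m _)^T]trmx_mul. Qed.

Definition bilinear_bound v := forall z w, basic_ellitope Rm RR z -> basic_ellitope Tm T w ->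
  \sum_s `|bform (M s) z w| <= v.

Lemma bilinear_bound_ge0 v : bilinear_bound v -> 0 <= v.
Proof.
move=> hv; apply: le_trans (hv 0 0 (basic_ellitope0 hR) (basic_ellitope0 hT)).
by apply: sumr_ge0.
Qed.

Lemma bform_comb (eps : 'I_S -> R) z w :
  bform (Q^T *m (\sum_s eps s *: A s) *m P) z w = \sum_s eps s * bform (M s) z w.
Proof.
rewrite mulmx_sumr mulmx_suml bform_summx; apply: eq_bigr => s _.
by rewrite -scalemxAr -scalemxAl bform_scalemx.
Qed.

(** The gauge of [x] is only approached: x = r P w with r <= 1 + d, and the excess d v is absorbed
    in [e]. *)
Lemma gauge_norm_polar_le v D x : 0 <= v ->
  (forall z w, basic_ellitope Rm RR z -> basic_ellitope Tm T w ->
    bform (Q^T *m D *m P) z w <= v) ->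
  gauge_norm X x <= 1 -> gauge_norm B (D *m x) <= v.
Proof.
move=> v0 hv gx; apply/ler_addgt0Pl => e e0.
apply: ge_inf; first exact: gauge_set_lb.
have ve : 0 < e + v by lra.
split => // _ [z Zz <-].
rewrite linearZ /= -scalemxAl mxE mulrC ler_pdivrMr // mul1r.
have hinf : has_inf [set r : R | 0 < r /\ X (r^-1 *: x)].
  split; last exact: gauge_set_lb.
  by have [r r0 Xr] := absorbing x; exists r.
pose d := e / (v + 1).
have d0 : 0 < d by rewrite divr_gt0 //; lra.
have dv : d * (v + 1) = e by rewrite /d divfK // gt_eqF //; lra.
have [r [r0 [w Ww wE]] rlt] := inf_adherent d0 hinf.
have rd : r <= 1 + d by apply/ltW/(lt_le_trans rlt); rewrite lerD2r.
have -> : x = r *: (P *m w) by rewrite wE scalerA divff ?gt_eqF // scale1r.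
rewrite -scalemxAr linearZ /= -scalemxAl mxE polar_pairing.
apply: (@le_trans _ _ (r * v)); first by rewrite ler_pM2l // hv.
by have := ler_wpM2r v0 rd; nra.
Qed.

Lemma op_norm_set_nonempty D : [set gauge_norm B (D *m x) | x in [set x | gauge_norm X x <=
  1]] !=set0.
Proof.
exists (gauge_norm B (D *m (P *m 0))), (P *m 0) => //=.
exact/gauge_norm_le1/basic_ellitope0.
Qed.

Lemma box_bound v (eps : 'I_S -> R) z w : bilinear_bound v -> (forall s, `|eps s| <= 1) ->
  basic_ellitope Rm RR z -> basic_ellitope Tm T w ->
  bform (Q^T *m (\sum_s eps s *: A s) *m P) z w <= v.
Proof.
move=> hv heps Zz Ww; apply: le_trans (hv z w Zz Ww).
rewrite bform_comb; apply: le_trans (ler_norm _) _; apply: le_trans (ler_norm_sum _ _ _) _.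
by apply: ler_sum => s _; rewrite normrM ler_piMl.
Qed.

Lemma op_norm_le v (eps : 'I_S -> R) : bilinear_bound v -> (forall s, `|eps s| <= 1) ->
  ubound [set gauge_norm B ((\sum_s eps s *: A s) *m x) | x in [set x | gauge_norm X x <= 1]] v.
Proof.
move=> hv heps _ [x /= gx <-]; apply: gauge_norm_polar_le gx; first exact: bilinear_bound_ge0.
by move=> z w Zz Ww; exact: box_bound.
Qed.

Lemma set_op_norm_ub v : bilinear_bound v -> ubound [set op_norm B X D | D in matrix_box A] v.
Proof.
move=> hv _ [_ [eps heps <-] <-].
by apply: ge_sup; [exact: op_norm_set_nonempty|exact: op_norm_le].
Qed.

Lemma set_op_norm_le v : bilinear_bound v -> set_op_norm B X (matrix_box A) <= v.
Proof.
move=> hv; apply: ge_sup (set_op_norm_ub hv).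
exists (op_norm B X (\sum_s 0 *: A s)), (\sum_s 0 *: A s) => //.
by exists (fun=> 0) => // s /=; rewrite normr0.
Qed.

(** The signs of the terms select a matrix of the box whose bilinear form is the sum of absolute
    values. The a priori bound [v] ensures that each [sup] is taken over a bounded set. *)
Lemma bilinear_bound_set_op_norm v : bilinear_bound v ->
  bilinear_bound (set_op_norm B X (matrix_box A)).
Proof.
move=> hv z w Zz Ww.
pose eps s := Num.sg (bform (M s) z w).
have heps s : `|eps s| <= 1 by rewrite /eps normr_sg; case: (_ != 0); rewrite ?lexx ?ler01.
pose D := \sum_s eps s *: A s.
have -> : \sum_s `|bform (M s) z w| = bform (Q^T *m D *m P) z w.
  by rewrite bform_comb; apply: eq_bigr => s _; rewrite normrEsg.
apply: (@le_trans _ _ (gauge_norm B (D *m (P *m w)))).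
  apply: lb_le_inf.
    have v0 := bilinear_bound_ge0 hv; have v1 : 0 < v + 1 by lra.
    (* Nonemptiness of the gauge set; v + 1 replaces [v] because members must be positive. *)
    exists (v + 1); split => // _ [z' Zz' <-].
    rewrite linearZ /= -scalemxAl mxE mulrC ler_pdivrMr // mul1r polar_pairing.
    by apply: le_trans (box_bound hv heps Zz' Ww) _; rewrite lerDl.
  move=> r [r0 /(_ (Q *m z))]; rewrite linearZ /= -scalemxAl mxE polar_pairing.
  by rewrite mulrC ler_pdivrMr // mul1r; apply; exists z.
apply: (@le_trans _ _ (op_norm B X D)).
  apply: ub_le_sup; first by exists v; exact: op_norm_le.
  by exists (P *m w) => //=; exact: gauge_norm_le1.
apply: ub_le_sup; first by exists v; exact: set_op_norm_ub.
by exists D => //; exists eps.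
Qed.

(** The sum of the joint matrices is definite and bounded on the product of the ellitopes, so (z, w)
    is bounded there. *)
Lemma bilinear_bound_exists : exists v, bilinear_bound v.
Proof.
have [c c0 hc] := pdmx_lb (joint_sum_pd hT hR).
have [b hb] := cs_bounded (ellitope_constraint_set hT).
have [b' hb'] := cs_bounded (ellitope_constraint_set hR).
pose d s := \sum_i \sum_j `|offdiag (M s) i j|.
have hd s i j : `|offdiag (M s) i j| <= d s.
  rewrite /d (bigD1 i) //= (bigD1 j) //= -addrA lerDl addr_ge0 // sumr_ge0 // => k _.
  exact: sumr_ge0.
have d0 s : 0 <= d s by apply: sumr_ge0 => i _; exact: sumr_ge0.
exists (\sum_s d s * (q + p)%:R * ((\sum_(l < L) b' +
  \sum_(k < K) b) / c)) => z w [r Rr hr] [t Tt ht].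
apply: ler_sum => s _; rewrite -qform_offdiag.
apply: le_trans (qform_entry_le _ (hd s)) _.
rewrite ler_wpM2l ?mulr_ge0 // ler_pdivlMr // mulrC.
apply: le_trans (hc _) _; rewrite qform_summx big_split_ord /=.
apply: lerD; apply: ler_sum => i _.
  by rewrite qform_jointl; apply: le_trans (hr i) _; exact: hb'.
by rewrite qform_jointr; apply: le_trans (ht i) _; exact: hb.
Qed.

Lemma feasible_bilinear_bound lam ups G H : opt_feasible P Q Tm Rm A lam ups G H ->
  bilinear_bound (support_fun T lam + support_fun RR ups).
Proof.
move=> [l0 u0 _ _ blk hG hH] z w [r Rr hr] [t Tt ht].
have h1 s : `|bform (M s) z w| <= qform (G s) z + qform (H s) w.
  have trE : P^T *m (A s)^T *m Q = (M s)^T by rewrite /M !trmx_mul trmxK mulmxA.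
  (* The two signs of [w] give the two halves of the absolute value. *)
  have := (proj2 (blk s)) (col_mx z w); have := (proj2 (blk s)) (col_mx z (- w)).
  rewrite !qform_block trE !bform_scalemx !bform_tr -/(M s).
  rewrite -[- w]scaleN1r bformZr qformZ sqrrN expr1n mul1r ler_norml; set x := bform _ _ _.
  by move=> ? ?; apply/andP; split; lra.
apply: le_trans (ler_sum _ (fun s _ => h1 s)) _.
rewrite big_split /= -!qform_summx addrC; apply: lerD.
  apply: le_trans (support_fun_ge hT l0 Tt).
  have := (proj2 hH) w; rewrite qform_addmx qform_oppmx subr_ge0 => h; apply: le_trans h _.
  by rewrite qform_summx; apply: ler_sum => k _; rewrite qform_scalemx ler_wpM2l.
apply: le_trans (support_fun_ge hR u0 Rr).
have := (proj2 hG) z; rewrite qform_addmx qform_oppmx subr_ge0 => h; apply: le_trans h _.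
by rewrite qform_summx; apply: ler_sum => k _; rewrite qform_scalemx ler_wpM2l.
Qed.

Lemma feasible_exists kappa v C : (0 < kappa)%N -> (forall s, (\rank (A s) <= kappa)%N) ->
  bilinear_bound v ->
  varkappa R K * varkappa R L * vartheta R (2 * kappa) * v < C ->
  exists2 u, u <= C & exists lam ups G H, opt_feasible P Q Tm Rm A lam ups G H /\
    u = support_fun T lam + support_fun RR ups.
Proof.
move=> k0 rk hv hC.
have rM s : (\rank (M s) <= kappa)%N.
  by apply: leq_trans (mxrankM_maxl _ _) _; apply: leq_trans (mxrankM_maxr _ _) (rk s).
have [lam [ups [G [H [[l0 u0] [sG sH] blk [hG hH] hle]]]]] :=
  relaxation_bound hT hR (bilinear_bound_ge0 hv) hv k0 rM hC.
exists (support_fun T lam + support_fun RR ups) => //.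
exists lam, ups, G, H; split => //; split => // s.
have -> : P^T *m (A s)^T *m Q = (M s)^T by rewrite /M !trmx_mul trmxK mulmxA.
exact: blk.
Qed.

Lemma norm_relaxation kappa : (0 < kappa)%N -> (forall s, (\rank (A s) <= kappa)%N) ->
  set_op_norm B X (matrix_box A) <= Opt P Q Tm T Rm RR A /\
  Opt P Q Tm T Rm RR A <= varkappa R K * varkappa R L * vartheta R (2 * kappa)
       * set_op_norm B X (matrix_box A).
Proof.
move=> k0 rk; have [v hv] := bilinear_bound_exists.
split.
  (* The lower bound on the infimum needs a feasible point; the construction behind the upper bound
     supplies one. *)
  apply: lb_le_inf.
    have [|u _ hu] := @feasible_exists kappa v
      (varkappa R K * varkappa R L * vartheta R (2 * kappa) * v + 1) k0 rk hv.
      by rewrite ltrDl.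
    by exists u.
  move=> _ [lam [ups [G [H [hf ->]]]]].
  exact: set_op_norm_le (feasible_bilinear_bound hf).
have hN := bilinear_bound_set_op_norm hv.
apply/ler_addgt0Pr => e e0.
have [|u uC hu] := @feasible_exists kappa _
    (varkappa R K * varkappa R L * vartheta R (2 * kappa) * set_op_norm B X (matrix_box A) +
      e) k0 rk hN.
  by rewrite ltrDl.
apply: le_trans uC; apply: ge_inf => //.
exists 0 => _ [lam [ups [G [H [hf ->]]]]].
exact: bilinear_bound_ge0 (feasible_bilinear_bound hf).
Qed.

End Gauge.
End Norms.

Unset Implicit Arguments.

Theorem proposition4p1 (R : realType) (n m p q K L S kappa : nat)
    (P : 'M[R]_(n, p)) (Q : 'M[R]_(m, q))
    (Tm : 'I_K -> 'M[R]_p) (T : set 'rV[R]_K)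
    (Rm : 'I_L -> 'M[R]_q) (RR : set 'rV[R]_L)
    (A : 'I_S -> 'M[R]_(m, n))
    (X : set 'cV[R]_n) (Bstar B : set 'cV[R]_m)
    (hT : ellitope_data Tm T) (hR : ellitope_data Rm RR)
    (hX : X = [set P *m w | w in basic_ellitope Tm T])
    (hBstar : Bstar = [set Q *m z | z in basic_ellitope Rm RR])
    (hXint : X° !=set0) (hBstarint : Bstar° !=set0)
    (hB : B = polar Bstar)
    (hkappa : (0 < kappa)%N) (hrank : forall s, (\rank (A s) <= kappa)%N) :
  set_op_norm B X (matrix_box A) <= Opt P Q Tm T Rm RR A /\
  Opt P Q Tm T Rm RR A
    <= varkappa R K * varkappa R L * vartheta R (2 * kappa)
       * set_op_norm B X (matrix_box A).
Proof.
subst B Bstar X; exact: norm_relaxation hkappa hrank.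
Qed.
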